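(* Let $G$ be a finite simple graph with totally ordered vertex set $I=\{\alpha_1<\dots<\alpha_n\}$, let $\lambda$ be a positive integer and $0\le m\le n$ an integer. Then $\widetilde{\chi}_G^{(m)}(\lambda)$ equals the number of $(m,\lambda)$-labelled acyclic orientations of $G$.
   Context: $\chi_G(q)$ is the chromatic polynomial of $G$, $\chi_G^{(m)}$ its $m$-th derivative, and $\widetilde{\chi}_G^{(m)}(q):=(-1)^{n-m}\chi_G^{(m)}(-q)$. Heaps: two vertices commute if they are distinct and non-adjacent. The heap monoid is the quotient of the free monoid on $I$ by the congruence generated by $ab=ba$ for commuting $a,b$, with product $\circ$ induced by concatenation. For a word $p_1\cdots p_r$ its pieces are partially ordered by the transitive closure of $p_s<p_t$ when $s<t$ and $p_s,p_t$ are equal or adjacent; this poset depends only on the heap; $\pi(E)$ is the set of positions of pieces of $E$. A heap is multilinear if each vertex occurs exactly once. Order words lexicographically (proper prefix smaller); $\operatorname{st}(E)$ is the largest word representing $E$ and $E\le F$ iff $\operatorname{st}(E)\le\operatorname{st}(F)$. $E$ is primitive if $E=U\circ V=V\circ U$ forces $U$ or $V$ empty; conjugacy is the transitive closure of $U\circ V\mapsto V\circ U$; a Lyndon heap is nonempty, primitive and minimal in its conjugacy class. Every heap factors uniquely as $E=E_1\circ\cdots\circ E_k$ with $E_i$ Lyndon and $E_1\ge\dots\ge E_k$ (Lyndon factorization). For a multilinear heap $E$ with Lyndon factorization $E_1\circ\cdots\circ E_k$, an $(m,\lambda)$-labelling of $E$ (possible only when $k\ge m$) is a function $f:I\to\mathbb{N}$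 constant on each $\pi(E_j)$, whose value on $\pi(E_j)$ lies in $\{1,\dots,k-j+1\}$ for $1\le j\le m$ and in $\{1,\dots,\lambda\}$ for $m<j\le k$. Each multilinear heap $E$ gives an acyclic orientation $\mathcal{O}_E$ of $G$ (edge $\{\alpha,\beta\}$ oriented $\alpha\to\beta$ iff piece $\alpha$ lies below $\beta$ in $E$), and $E\mapsto\mathcal{O}_E$ is a bijection onto the acyclic orientations of $G$. An $(m,\lambda)$-labelled acyclic orientation is a pair $(\mathcal{O}_E,f)$ with $f$ an $(m,\lambda)$-labelling of $E$. *)

(* Defs.v *)
From HB Require Import structures.
From mathcomp Require Import all_boot all_order all_algebra.
From mathcomp Require Import boolp.
From Stdlib Require Import Relation_Operators.

Set Implicit Arguments.
Unset Strict Implicit.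
Unset Printing Implicit Defensive.

Import Order.TTheory GRing.Theory Num.Theory.

(* A finite simple graph on I is given by its adjacency relation adj : rel I,
   with symmetry and irreflexivity as hypotheses of the theorem. *)

Section ChromaticPolynomial.
Variables (I : finType) (adj : rel I).
Local Open Scope ring_scope.

Definition proper_coloring (q : nat) (c : {ffun I -> 'I_q}) : bool :=
  [forall x, forall y, adj x y ==> (c x != c y)].

Definition stable (B : {set I}) : bool :=
  [forall x in B, forall y in B, ~~ adj x y].

Definition stable_partition (P : {set {set I}}) : bool :=
  partition P [set: I] && [forall B in P, stable B].

(* A proper q-colouring is a partition of I into stable classes together with
   distinct colours for the classes, whence the falling factorials.  See
   chrom_polyE and chrom_poly_uniq below: this is the unique polynomial that
   counts the proper colourings with q colours for every q. *)
Definition chrom_poly : {poly int} :=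
  \sum_(P : {set {set I}} | stable_partition P)
    \prod_(i < #|P|) ('X - i%:R%:P).

Definition chrom_tilde (m : nat) (q : int) : int :=
  (-1) ^+ (#|I| - m) * (chrom_poly^`(m)).[- q].

Lemma ffact_poly (k q : nat) :
  (\prod_(i < k) ('X - i%:R%:P) : {poly int}).[q%:R] = (q ^_ k)%:R.
Proof.
elim: k => [|k IHk]; first by rewrite big_ord0 hornerC.
rewrite big_ord_recr /= hornerM IHk !hornerE ffactnSr natrM.
have [le_kq | lt_qk] := leqP k q; first by rewrite natrB.
by rewrite ffact_small // !mul0r.
Qed.

Lemma card_colorings_of_partition (q : nat) (P : {set {set I}}) :
  stable_partition P ->
  #|[set c : {ffun I -> 'I_q} | proper_coloring c
       & preim_partition c [set: I] == P]| = q ^_ #|P|.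
Proof.
move=> /andP[partP stP].
have trP := partition_trivIset partP; have covP := cover_partition partP.
have inP x : pblock P x \in P by rewrite pblock_mem // covP inE.
have xinP x : x \in pblock P x by rewrite mem_pblock covP inE.
pose D := {B : {set I} | B \in P}.
pose phi (g : {ffun D -> 'I_q}) : {ffun I -> 'I_q} :=
  [ffun x => g (exist _ (pblock P x) (inP x))].
have <- : #|{: D}| = #|P| by rewrite card_sig; apply: eq_card.
rewrite -[q in RHS](card_ord q) -card_inj_ffuns.
have blockD (B : D) : exists x, exist _ (pblock P x) (inP x) = B.
  case: B => B PB; have [B0|[x Bx]] := set_0Vmem B.
    by have := partition0 partP; rewrite -B0 PB.
  by exists x; apply: val_inj; rewrite /= (def_pblock trP PB Bx).
have phi_inj : injective phi.
  move=> g h /ffunP eq_gh; apply/ffunP => B; have [x <-] := blockD B.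
  by have := eq_gh x; rewrite !ffunE.
rewrite -(card_imset _ phi_inj); apply: eq_card => c.
rewrite inE; apply/andP/imsetP => [[propc /eqP defP] | [g]].
  have eqc x y : (c x == c y) = (pblock P x == pblock P y).
    rewrite eq_pblock ?covP ?inE // -defP pblock_equivalence_partition ?inE //.
    by split=> // /eqP ->.
  have PbD (B : D) : [exists x, exist _ (pblock P x) (inP x) == B].
    by have [x <-] := blockD B; apply/existsP; exists x.
  pose g : {ffun D -> 'I_q} := [ffun B => c (xchoose (existsP (PbD B)))].
  have gE x : g (exist _ (pblock P x) (inP x)) = c x.
    rewrite ffunE; apply/eqP; rewrite eqc.
    set E := existsP _.
    by have /eqP/(congr1 val) /= -> := xchooseP E.
  exists g; last by apply/ffunP => x; rewrite ffunE gE.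
  rewrite inE; apply/injectiveP => B1 B2.
  have [x <-] := blockD B1; have [y <-] := blockD B2.
  by rewrite !gE => /eqP; rewrite eqc => /eqP exy; apply: val_inj.
rewrite inE => /injectiveP g_inj ->.
have eqc x y : (phi g x == phi g y) = (pblock P x == pblock P y).
  by rewrite !ffunE (inj_eq g_inj).
split.
  apply/forallP => x; apply/forallP => y; apply/implyP => Axy.
  rewrite eqc; apply/eqP => exy.
  have /forall_inP/(_ _ (inP x))/forall_inP/(_ _ (xinP x)) := stP.
  by move=> /forall_inP/(_ y); rewrite exy Axy => /(_ (xinP y)).
rewrite -[X in _ == X](equivalence_partition_pblock partP).
apply/eqP; apply: eq_in_imset => x _; apply/setP => y.
by rewrite !inE /= eqc eq_pblock ?covP ?inE.
Qed.

Lemma chrom_polyE (q : nat) :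
  chrom_poly.[q%:R] = #|[set c : {ffun I -> 'I_q} | proper_coloring c]|%:R.
Proof.
rewrite -sum1dep_card.
rewrite (partition_big (fun c : {ffun I -> 'I_q} =>
  preim_partition c [set: I]) stable_partition) /=; last first.
  move=> c propc; rewrite /stable_partition preim_partitionP /=.
  apply/forall_inP => _ /imsetP[x _ ->].
  apply/forall_inP => y; rewrite !inE /= => /eqP cxy.
  apply/forall_inP => z; rewrite !inE /= => /eqP cxz.
  apply/negP => Ayz; have /forallP/(_ y)/forallP/(_ z) := propc.
  by rewrite Ayz -cxy -cxz eqxx.
rewrite natr_sum horner_sum; apply: eq_bigr => P stP.
by rewrite ffact_poly sum1dep_card card_colorings_of_partition.
Qed.

Lemma chrom_poly_uniq (p : {poly int}) :
  (forall q : nat,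
    p.[q%:R] = #|[set c : {ffun I -> 'I_q} | proper_coloring c]|%:R) ->
  p = chrom_poly.
Proof.
move=> pE; apply/eqP; rewrite -subr_eq0; apply: contraT => nz.
pose s := [seq i%:R : int | i <- iota 0 (size (p - chrom_poly))].
have : (size s < size (p - chrom_poly)%R)%N.
  apply: max_poly_roots => //.
    apply/allP => _ /mapP[i _ ->].
    by rewrite /root !hornerE pE chrom_polyE subrr.
  by rewrite map_inj_uniq ?iota_uniq // => i j /eqP; rewrite eqr_nat => /eqP.
by rewrite size_map size_iota ltnn.
Qed.

End ChromaticPolynomial.

Section Heaps.
Variables (d : Order.disp_t) (I : finOrderType d) (adj : rel I).

Definition commuting (a b : I) : bool := (a != b) && ~~ adj a b.

Inductive heap_cong : seq I -> seq I -> Prop :=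
| heap_cong_swap a b : commuting a b -> heap_cong [:: a; b] [:: b; a]
| heap_cong_refl u : heap_cong u u
| heap_cong_sym u v : heap_cong u v -> heap_cong v u
| heap_cong_trans u v w : heap_cong u v -> heap_cong v w -> heap_cong u w
| heap_cong_cat u u' v v' :
    heap_cong u u' -> heap_cong v v' -> heap_cong (u ++ v) (u' ++ v').

Definition heap_congb : rel (seq I) := fun u v => `[< heap_cong u v >].

Lemma heap_congb_refl : reflexive heap_congb.
Proof. by move=> u; apply/asboolP; apply: heap_cong_refl. Qed.

Lemma heap_congb_sym : symmetric heap_congb.
Proof. by move=> u v; apply/asboolP/asboolP; apply: heap_cong_sym. Qed.

Lemma heap_congb_trans : transitive heap_congb.
Proof.
move=> v u w /asboolP Huv /asboolP Hvw; apply/asboolP.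
exact: heap_cong_trans Hvw.
Qed.

Canonical heap_equiv :=
  EquivRel heap_congb heap_congb_refl heap_congb_sym heap_congb_trans.

Local Open Scope quotient_scope.

Definition heap := {eq_quot heap_congb}.
HB.instance Definition _ : EqQuotient _ heap_congb heap := EqQuotient.on heap.
HB.instance Definition _ := Choice.on heap.

Definition heap_of (w : seq I) : heap := \pi_heap w.

Lemma heap_ofP (u v : seq I) : heap_of u = heap_of v <-> heap_cong u v.
Proof.
rewrite /heap_of; split => [/eqmodP/asboolP //|Huv].
by apply/eqmodP/asboolP.
Qed.

Definition heap_mul (E F : heap) : heap := heap_of (repr E ++ repr F).
Definition heap_nil : heap := heap_of [::].

Lemma heap_mul_of (u v : seq I) :
  heap_mul (heap_of u) (heap_of v) = heap_of (u ++ v).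
Proof. by apply/heap_ofP/heap_cong_cat; apply/heap_ofP; rewrite /heap_of reprK. Qed.

Lemma heap_cong_perm (u v : seq I) : heap_cong u v -> perm_eq u v.
Proof.
elim=> {u v} [a b _|u|u v _|u v w _ uv _ vw|u u' v v' _ uu' _ vv'] //.
- by rewrite (perm_catC [:: a] [:: b]).
- by rewrite perm_sym.
- exact: perm_trans vw.
- exact: perm_cat.
Qed.

(* Standard word: the words representing E are among the permutations of any
   one of them.  The default [::] of the maximum is the smallest word. *)
Definition st (E : heap) : seqlexi I :=
  \big[Order.max/([::] : seqlexi I)]_(w <- permutations (repr E)
                                      | heap_of w == E) (w : seqlexi I).

Lemma stP (E : heap) :
  heap_of (st E) = E
  /\ forall w : seqlexi I, heap_of w = E -> (w <= st E)%O.
Proof.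
have inE w : heap_of w = E -> w \in permutations (repr E).
  move=> wE; rewrite mem_permutations; apply: heap_cong_perm.
  by apply/heap_ofP; rewrite wE /heap_of reprK.
have ge_st (w : seqlexi I) : heap_of w = E -> (w <= st E)%O.
  move=> wE; apply: (@le_bigmax_seq _ _ _ _ ([::] : seqlexi I) w) => //.
    exact: inE.
  exact/eqP.
split=> //.
have reprE : heap_of (repr E) = E by rewrite /heap_of reprK.
suff: st E = [::] :> seq I \/ heap_of (st E) = E.
  case=> // st0; have := ge_st _ reprE; rewrite st0.
  by case: (repr E) reprE.
rewrite {1 2}/st; elim/big_rec: _ => [|w F /eqP wE IH]; first by left.
by rewrite /Order.max; case: ifP => _ //; right.
Qed.

Definition heap_le (E F : heap) : bool := (st E <= st F)%O.

Definition primitive (E : heap) : Prop :=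
  forall U V : heap, E = heap_mul U V -> E = heap_mul V U ->
    U = heap_nil \/ V = heap_nil.

Definition conjugate : heap -> heap -> Prop :=
  clos_trans heap (fun E F =>
    exists U V : heap, E = heap_mul U V /\ F = heap_mul V U).

Definition lyndon (E : heap) : Prop :=
  [/\ E <> heap_nil, primitive E & forall F, conjugate E F -> heap_le E F].

Definition lyndon_factorization (E : heap) (Es : seq heap) : Prop :=
  [/\ E = foldr heap_mul heap_nil Es,
      forall F, F \in Es -> lyndon F
    & sorted (fun F F' => heap_le F' F) Es].

Definition multilinear (E : heap) : Prop :=
  forall x : I, count_mem x (repr E) = 1.

(* pi(E): the set of positions (vertices) of the pieces of E. *)
Definition positions (E : heap) : {set I} := [set x in repr E].

Definition piece_step (w : seq I) (s t : 'I_(size w)) : Prop :=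
  let p := tnth (in_tuple w) in
  s < t /\ (p s = p t \/ adj (p s) (p t)).

Definition piece_lt (w : seq I) : 'I_(size w) -> 'I_(size w) -> Prop :=
  clos_trans _ (@piece_step w).

Definition below (E : heap) (a b : I) : Prop :=
  exists s t : 'I_(size (repr E)),
    [/\ tnth (in_tuple (repr E)) s = a, tnth (in_tuple (repr E)) t = b
      & piece_lt s t].

(* O_E as a set of arcs: (a, b) stands for a -> b. *)
Definition orientation_of (E : heap) : {set I * I} :=
  [set e : I * I | adj e.1 e.2 && `[< below E e.1 e.2 >]].

(* Here j is 0-based: the interval {1, ..., k - j + 1} of the j-th factor,
   j <= m, becomes {1, ..., k - j} for j < m. *)
Definition labelling (m lambda : nat) (E : heap) (f : {ffun I -> nat}) : Prop :=
  exists Es : seq heap,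
    [/\ lyndon_factorization E Es,
        m <= size Es
      & forall j, j < size Es ->
          let piEj := positions (nth heap_nil Es j) in
          {in piEj &, forall x y, f x = f y} /\
          {in piEj, forall x,
             1 <= f x <= (if j < m then size Es - j else lambda)}].

Definition labelled_acyclic_orientation (m lambda : nat)
    (Of : {set I * I} * {ffun I -> nat}) : Prop :=
  exists E : heap,
    [/\ multilinear E, Of.1 = orientation_of E & labelling m lambda E Of.2].

Definition acyclic_orientation (O : {set I * I}) : Prop :=
  [/\ forall a b, (a, b) \in O -> adj a b,
      forall a b, adj a b -> ((a, b) \in O) (+) ((b, a) \in O)
    & forall a, ~ clos_trans I (fun b c => (b, c) \in O) a a].

Lemma multilinear_orientation (E : heap) :
  symmetric adj -> irreflexive adj -> multilinear E ->
  acyclic_orientation (orientation_of E).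
Proof.
move=> adj_sym adj_irr mlE; set w := repr E.
have uw : uniq w.
  by apply: count_mem_uniq => x; rewrite -has_pred1 has_count mlE.
have inw x : x \in w by rewrite -has_pred1 has_count mlE.
have ltE s t : @piece_lt w s t -> s < t.
  by elim=> {s t} [s t []|s t r _ st _ tr] //; apply: ltn_trans tr.
have idx (s : 'I_(size w)) : index (tnth (in_tuple w) s) w = s.
  by rewrite (tnth_nth (tnth (in_tuple w) s)) index_uniq.
have arcE a b : ((a, b) \in orientation_of E)
              = adj a b && (index a w < index b w).
  rewrite inE /=; case Aab: (adj a b) => //=.
  apply/asboolP/idP => [[s [t [<- <- /ltE]]]|ltab]; first by rewrite !idx.
  have lta : index a w < size w by rewrite index_mem.
  have ltb : index b w < size w by rewrite index_mem.
  have ea : tnth (in_tuple w) (Ordinal lta) = a.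
    by rewrite (tnth_nth a) /= nth_index.
  have eb : tnth (in_tuple w) (Ordinal ltb) = b.
    by rewrite (tnth_nth a) /= nth_index.
  exists (Ordinal lta), (Ordinal ltb); split=> //.
  by apply: t_step; split=> //=; rewrite ea eb; right.
split=> [a b|a b Aab|a].
- by rewrite arcE => /andP[].
- rewrite !arcE (adj_sym b a) Aab /=.
  case: (ltngtP (index a w) (index b w)) => // eqi.
  have eab : a = b by rewrite -(nth_index a (inw a)) eqi nth_index.
  by rewrite eab adj_irr in Aab.
- have lt_cl b c : clos_trans I (fun b c => (b, c) \in orientation_of E) b c ->
      index b w < index c w.
    elim=> {b c} [b c|b c e _ bc _ ce]; first by rewrite arcE => /andP[].
    exact: ltn_trans ce.
  by move/lt_cl; rewrite ltnn.
Qed.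

End Heaps.

(* Main.v *)
(** A multilinear heap is determined by its set of vertices and its acyclic
    orientation.  Such a heap is Lyndon exactly when its smallest vertex a is
    its only minimal piece (a pyramid with base a): a connected heap is
    conjugate to a pyramid with base a, which is unique because conjugation
    changes the orientation by the differences of a potential, and the standard
    word of a pyramid with base a is the only one in the class that starts with
    a.  Hence the last Lyndon factor of E is the set of pieces above min E, and
    P_S(y) = sum_E y^(number of Lyndon factors of E), over the heaps E on S,
    satisfies P_S(y) = y sum_V p(V) P_(S-V)(y), where p(V) counts the pyramids
    on V with base min S.  A sign-reversing involution on stable top layers of
    pyramids turns this into P_S(y - 1) = sum_T (-1)^|T| P_(S-T)(y), over the
    stable T in S; this is the recursion for proper colourings, read at -q, so
    that chi_G(q) = (-1)^n P_I(-q).  The m-th derivative of y^k at lambda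
    is k(k-1)...(k-m+1) lambda^(k-m), which is the number of
    (m,lambda)-labellings of a heap with k Lyndon factors. *)
Require Import Defs.
From mathcomp Require Import all_boot all_order all_algebra.
From mathcomp Require Import boolp classical_sets functions cardinality.
From Stdlib Require Import Relation_Operators.
From mathcomp Require Import fintype finset zify ring.

Set Implicit Arguments.
Unset Strict Implicit.
Unset Printing Implicit Defensive.

Import Order.TTheory GRing.Theory Num.Theory.

Section HeapsOfGraph.
Variables (d : Order.disp_t) (I : finOrderType d) (adj : rel I).
Hypotheses (adj_sym : symmetric adj) (adj_irr : irreflexive adj).
Implicit Types (E F U V : heap adj) (A B S T : {set I}) (w : seq I).

Local Notation heap_of := (heap_of adj).

(** * Words up to commutation and their arcs *)

Definition warc (w : seq I) (x y : I) : bool :=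
  [&& adj x y, x \in w, y \in w & index x w < index y w].

(** A swap exchanges two distinct non-adjacent letters, so at most one of them is [x] or [y], and
    the projection of the word to these two letters does not change. *)
Lemma heap_cong_filter (u v : seq I) (x y : I) : adj x y -> heap_cong adj u v ->
  [seq z <- u | pred2 x y z] = [seq z <- v | pred2 x y z].
Proof.
move=> Axy; elim=> {u v} //.
- move=> a b /andP[neq nA] /=.
  case: (eqVneq a x) => [ax|ax] /=; case: (eqVneq b y) => [b_y|b_y] /=.
  + by rewrite -ax -b_y (negPf nA) in Axy.
  + by case: (eqVneq b x) => [bx|]; first by rewrite ax bx eqxx in neq.
  + by case: (eqVneq a y) => [ay|]; first by rewrite ay b_y eqxx in neq.
  + case: (eqVneq a y) => [ay|]; case: (eqVneq b x) => [bx|] //=.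
    by rewrite ay bx adj_sym Axy in nA.
- by move=> u v w _ -> _ ->.
- by move=> u u' v v' _ uu' _ vv'; rewrite !filter_cat uu' vv'.
Qed.

Lemma filter_pred2_index (w : seq I) (x y : I) :
    uniq w -> x != y -> x \in w -> y \in w ->
  (index x w < index y w) = ([seq z <- w | pred2 x y z] == [:: x; y]).
Proof.
elim: w => //= z w IH /andP[zw uw] neq.
rewrite !inE ![z == _]eq_sym.
have fil1 (t : I) : t \in w -> [seq z <- w | pred1 t z] = [:: t].
  by move=> tw; apply: filter_pred1_uniq.
case: (eqVneq x z) => [xz|xz] /=; case: (eqVneq y z) => [yz|yz] /=.
- by rewrite xz yz eqxx in neq.
- move=> _ yw; rewrite ltn0Sn -xz eqseq_cons eqxx /=.
  rewrite -xz in zw; symmetry; apply/eqP; rewrite -[RHS](fil1 y yw).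
  apply: eq_in_filter => t tw /=; case: (eqVneq t x) => // tx.
  by rewrite -tx tw in zw.
- by move=> xw _; rewrite ltn0 -yz eqseq_cons (negPf (_ : y != x)) // eq_sym.
- by move=> xw yw; rewrite ltnS IH.
Qed.

(** Turns the comparison of indices into a condition on the projection to two letters, which
    [heap_cong_filter] shows to be invariant. *)
Lemma warcE (w : seq I) (x y : I) : uniq w ->
  warc w x y = adj x y && ([seq z <- w | pred2 x y z] == [:: x; y]).
Proof.
move=> uw; rewrite /warc; case Axy: (adj x y) => //=.
have neq : x != y by apply/eqP => xy; rewrite xy adj_irr in Axy.
case xw: (x \in w) => /=; last first.
  symmetry; apply/eqP => e; have : x \in [:: x; y] by rewrite mem_head.
  by rewrite -e mem_filter xw andbF.
case yw: (y \in w) => /=; last first.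
  symmetry; apply/eqP => e; have : y \in [:: x; y] by rewrite !inE eqxx orbT.
  by rewrite -e mem_filter yw andbF.
exact: filter_pred2_index.
Qed.

Lemma heap_cong_warc (u v : seq I) : uniq u -> heap_cong adj u v ->
  warc u =2 warc v.
Proof.
move=> uu uv x y; have uv' : uniq v by rewrite -(perm_uniq (heap_cong_perm uv)).
rewrite !warcE //; case Axy: (adj x y) => //=.
by rewrite (heap_cong_filter Axy uv).
Qed.

Lemma heap_cong_move (x : I) (u : seq I) :
  (forall y, y \in u -> commuting adj y x) -> heap_cong adj (rcons u x) (x :: u).
Proof.
elim: u => [|y u IH] H /=; first exact: heap_cong_refl.
apply: (@heap_cong_trans _ _ _ _ (y :: x :: u)).
  apply: (@heap_cong_cat _ _ _ [:: y] [:: y]); first exact: heap_cong_refl.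
  by apply: IH => z zu; apply: H; rewrite inE zu orbT.
apply: (@heap_cong_cat _ _ _ [:: y; x] [:: x; y] u u); last exact: heap_cong_refl.
by apply: heap_cong_swap; apply: H; rewrite mem_head.
Qed.

(** Induction on [u]. Write [v] as [v1 ++ x :: v2] with [x] the first letter of [u]. A letter of
    [v1] adjacent to [x] would give an arc from [x] in [u] that is reversed in [v]; hence [x]
    commutes with all of [v1] and can be brought to the front. *)
Lemma warc_cong (u v : seq I) : uniq u -> perm_eq u v ->
  (forall x y, warc u x y -> warc v x y) -> heap_cong adj u v.
Proof.
elim: u v => [|x u IH] v; last move=> uu puv sub.
  move=> _ pv _; have /perm_nilP -> : perm_eq v [::] by rewrite perm_sym.
  exact: heap_cong_refl.
have uv : uniq v by rewrite -(perm_uniq puv).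
have xv : x \in v by rewrite -(perm_mem puv) mem_head.
case/splitPr: xv puv uv sub => v1 v2 puv uv sub.
move: uu => /= /andP[xu uu].
have pu : perm_eq u (v1 ++ v2).
  rewrite -(perm_cons x); apply: perm_trans puv _.
  exact: permEl (perm_catCA v1 [:: x] v2).
have xv1 : x \notin v1.
  by move: uv; rewrite cat_uniq /= negb_or => /and3P[_ /andP[]].
have com y : y \in v1 -> commuting adj y x.
  move=> yv1; apply/andP; split.
    by apply/eqP => yx; rewrite yx (negPf xv1) in yv1.
  apply/negP => Ayx; have yu : y \in u by rewrite (perm_mem pu) mem_cat yv1.
  have neq : (x == y) = false by apply/eqP => xy; rewrite xy yu in xu.
  have := sub x y; rewrite /warc adj_sym Ayx /= !inE eqxx yu orbT neq /=.
  move=> /(_ isT) /and3P[_ _]; rewrite !index_cat (negPf xv1) yv1 /=.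
  rewrite eqxx addn0 ltnNge => /negP; apply.
  by rewrite ltnW // index_mem.
apply: heap_cong_sym; apply: (@heap_cong_trans _ _ _ _ (x :: v1 ++ v2)).
  rewrite -cat_rcons -cat_cons; apply: heap_cong_cat; last exact: heap_cong_refl.
  exact: heap_cong_move.
apply: (@heap_cong_cat _ _ _ [:: x] [:: x]); first exact: heap_cong_refl.
apply: heap_cong_sym; apply: IH => // y z /and4P[Ayz yu zu lt].
have nxy : (x == y) = false by apply/eqP => e; rewrite e yu in xu.
have nxz : (x == z) = false by apply/eqP => e; rewrite e zu in xu.
have := sub y z; rewrite /warc Ayz /= nxy nxz !inE yu zu !orbT ltnS lt.
move=> /(_ isT) /and3P[]; rewrite !mem_cat !inE !index_cat /= nxy nxz.
rewrite ![_ == x]eq_sym nxy nxz /= => -> -> /=.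
have := index_mem y v1; have := index_mem z v1.
case: (y \in v1); case: (z \in v1) => //.
- by move=> _ h _; apply: leq_trans h _; apply: leq_addr.
- by move=> _ _; rewrite addnS => /ltnW.
- by move=> _ _; rewrite !addnS ltnS.
Qed.

(** * Square-free heaps *)

(** These notions read the chosen word [repr E]. By [sqf_heap_of] and [harc_heap_of], any word of a
    square-free heap gives the same answer for [sqf] and [harc]; [rank] does depend on the choice
    and serves as a linear extension of the arcs. *)
Definition sqf E : bool := uniq (repr E).
Definition harc E : rel I := warc (repr E).
Definition rank E (x : I) : nat := index x (repr E).
Definition res A E : heap adj := heap_of [seq x <- repr E | x \in A].

Lemma heap_ofK E : heap_of (repr E) = E.
Proof. by rewrite /Defs.heap_of reprK. Qed.

Lemma repr_heap_cong w : heap_cong adj (repr (heap_of w)) w.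
Proof. by apply/heap_ofP; rewrite heap_ofK. Qed.

Lemma mem_positions E x : (x \in positions E) = (x \in repr E).
Proof. by rewrite inE. Qed.

Lemma sqf_heap_of w : sqf (heap_of w) = uniq w.
Proof. exact: perm_uniq (heap_cong_perm (repr_heap_cong w)). Qed.

Lemma mem_heap_of w x : (x \in positions (heap_of w)) = (x \in w).
Proof.
by rewrite mem_positions (perm_mem (heap_cong_perm (repr_heap_cong w))).
Qed.

Lemma harc_heap_of w : uniq w -> harc (heap_of w) =2 warc w.
Proof.
by move=> uw; apply: heap_cong_warc (repr_heap_cong w) => //; rewrite -sqf_heap_of in uw.
Qed.

(** The extensionality principle behind most equalities of heaps below. *)
Lemma heap_ext E F : sqf E -> sqf F -> positions E = positions F ->
  (forall x y, harc E x y -> harc F x y) -> E = F.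
Proof.
move=> uE uF eqp sub; rewrite -(heap_ofK E) -(heap_ofK F); apply/heap_ofP.
apply: warc_cong => //; apply: uniq_perm => // x.
by rewrite -!mem_positions eqp.
Qed.

Lemma harc_adj E x y : harc E x y -> adj x y.
Proof. by case/and4P. Qed.
Lemma harc_posl E x y : harc E x y -> x \in positions E.
Proof. by rewrite mem_positions; case/and4P. Qed.
Lemma harc_posr E x y : harc E x y -> y \in positions E.
Proof. by rewrite mem_positions; case/and4P. Qed.
Lemma harc_rank E x y : harc E x y -> rank E x < rank E y.
Proof. by case/and4P. Qed.

Lemma harc_total E x y : adj x y -> x \in positions E -> y \in positions E ->
  harc E x y || harc E y x.
Proof.
move=> Axy; rewrite !mem_positions => xE yE.
rewrite /harc /warc (adj_sym y x) Axy xE yE /=.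
case: ltngtP => // e; suff xy : x = y by rewrite xy adj_irr in Axy.
by rewrite -(nth_index x xE) e nth_index.
Qed.

Lemma mem_mul U V x :
  (x \in positions (heap_mul U V)) = (x \in positions U) || (x \in positions V).
Proof. by rewrite mem_heap_of mem_cat -!mem_positions. Qed.

Lemma positions_mul U V : positions (heap_mul U V) = positions U :|: positions V.
Proof. by apply/setP => x; rewrite mem_mul in_setU. Qed.

Lemma sqf_mul U V :
  sqf (heap_mul U V) = [&& sqf U, sqf V & [disjoint positions U & positions V]].
Proof.
rewrite sqf_heap_of cat_uniq; congr (_ && _); rewrite andbC; congr (_ && _).
rewrite disjoint_sym disjoints_subset; apply/hasPn/subsetP => H x xV.
  by rewrite in_setC mem_positions H // -mem_positions.
by rewrite -mem_positions -in_setC H // mem_positions.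
Qed.

Lemma harc_mul U V x y : sqf (heap_mul U V) ->
  harc (heap_mul U V) x y =
    [|| harc U x y, harc V x y
      | [&& adj x y, x \in positions U & y \in positions V]].
Proof.
move=> um; have := um; rewrite sqf_mul => /and3P[uU uV].
rewrite disjoint_sym disjoints_subset => /subsetP dis.
rewrite harc_heap_of; last by rewrite -sqf_heap_of.
rewrite /harc /warc; case: (adj x y) => //=.
have := dis x; have := dis y; rewrite !mem_positions !in_setC !mem_positions.
rewrite !mem_cat !index_cat.
have := index_mem x (repr U); have := index_mem y (repr U).
case: (x \in repr U); case: (x \in repr V);
  case: (y \in repr U); case: (y \in repr V) => //=;
  try by [move=> _ _ /(_ isT)|move=> _ _ _ /(_ isT)].
- by rewrite orbF.
- by move=> _ h _ _; apply: leq_trans h (leq_addr _ _).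
- move=> h _ _ _; apply/negbTE; rewrite -leqNgt.
  by apply: leq_trans (ltnW h) (leq_addr _ _).
- by rewrite ltn_add2l orbF.
Qed.

Lemma positions_res A E : positions (res A E) = positions E :&: A.
Proof. by apply/setP => x; rewrite mem_heap_of mem_filter in_setI mem_positions andbC. Qed.

Lemma sqf_res A E : sqf E -> sqf (res A E).
Proof. by move=> uE; rewrite sqf_heap_of filter_uniq. Qed.

Lemma harc_res A E x y : sqf E ->
  harc (res A E) x y = [&& x \in A, y \in A & harc E x y].
Proof.
move=> uE; rewrite harc_heap_of ?filter_uniq //.
apply/idP/and3P => [h|[xA yA h]].
  have : x \in [seq x <- repr E | x \in A] by case/and4P: h.
  have : y \in [seq x <- repr E | x \in A] by case/and4P: h.
  rewrite !mem_filter => /andP[yA yE] /andP[xA xE]; split => //.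
  move: h; rewrite /harc !warcE ?filter_uniq // => /andP[-> /eqP <-].
  rewrite -filter_predI; apply/eqP/eq_filter => z /=.
  by case: eqP => [->|_]; [rewrite xA|case: eqP => [->|//]; rewrite yA].
move: h; rewrite /harc !warcE ?filter_uniq // => /andP[-> /eqP <-].
rewrite -filter_predI; apply/eqP/eq_filter => z /=.
by case: eqP => [->|_]; [rewrite xA|case: eqP => [->|//]; rewrite yA].
Qed.

Lemma heap_mulA : associative (@heap_mul d I adj).
Proof.
move=> U V W; rewrite -(heap_ofK U) -(heap_ofK V) -(heap_ofK W).
by rewrite !heap_mul_of catA.
Qed.

Lemma heap_mul1 : left_id (heap_nil adj) (@heap_mul d I adj).
Proof. by move=> U; rewrite -(heap_ofK U) heap_mul_of. Qed.

Lemma heap_mulr1 : right_id (heap_nil adj) (@heap_mul d I adj).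
Proof. by move=> U; rewrite -(heap_ofK U) heap_mul_of cats0. Qed.

Lemma positions_nil : positions (heap_nil adj) = set0.
Proof. by apply/setP => x; rewrite mem_heap_of in_set0. Qed.

Lemma positions_eq0 E : positions E = set0 -> E = heap_nil adj.
Proof.
move=> E0; rewrite -(heap_ofK E) /heap_nil; congr heap_of.
by case: (repr E) (mem_positions E) => // x s /(_ x); rewrite E0 in_set0 mem_head.
Qed.

(** [A] is closed under predecessors, so no arc enters it from outside and its pieces can be placed
    first. *)
Lemma heap_split A E : sqf E ->
  (forall x y, harc E x y -> y \in A -> x \in A) ->
  heap_mul (res A E) (res (~: A) E) = E.
Proof.
move=> uE dA; have um : sqf (heap_mul (res A E) (res (~: A) E)).
  rewrite sqf_mul !sqf_res //= !positions_res disjoints_subset.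
  by apply/subsetP => x; rewrite !inE => /andP[_ ->]; rewrite andbF.
apply: heap_ext => //.
  by rewrite positions_mul !positions_res -setIUr setUCr setIT.
move=> x y; rewrite harc_mul // !harc_res // !positions_res !in_setI !in_setC.
case/or3P => [/and3P[]//|/and3P[]//|/and3P[Axy /andP[xE xA] /andP[yE yA]]].
case/orP: (harc_total Axy xE yE) => // /dA /(_ xA).
by rewrite (negPf yA).
Qed.

Lemma res_mull A U V : sqf (heap_mul U V) ->
  positions U \subset A -> positions V \subset ~: A ->
  res A (heap_mul U V) = U.
Proof.
move=> um /subsetP UA /subsetP VA; have := um; rewrite sqf_mul => /and3P[uU uV dis].
apply: heap_ext => //; first exact: sqf_res.
  apply/setP => x; rewrite positions_res in_setI mem_mul.
  case xU: (x \in positions U); first by rewrite UA.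
  by case xV: (x \in positions V) => //=; move: (VA x xV); rewrite in_setC => /negPf.
move=> x y; rewrite harc_res // harc_mul // => /and3P[xA yA].
by case/or3P => // [/harc_posl/VA|/and3P[_ _ /VA]]; rewrite in_setC ?xA ?yA.
Qed.

Lemma res_mulr A U V : sqf (heap_mul U V) ->
  positions U \subset ~: A -> positions V \subset A ->
  res A (heap_mul U V) = V.
Proof.
move=> um /subsetP UA /subsetP VA; have := um; rewrite sqf_mul => /and3P[uU uV dis].
apply: heap_ext => //; first exact: sqf_res.
  apply/setP => x; rewrite positions_res in_setI mem_mul.
  case xV: (x \in positions V); first by rewrite VA // orbT.
  by case xU: (x \in positions U) => //=; move: (UA x xU); rewrite in_setC => /negPf.
move=> x y; rewrite harc_res // harc_mul // => /and3P[xA yA].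
by case/or3P => // [/harc_posl/UA|/and3P[_ /UA]]; rewrite in_setC ?xA ?yA.
Qed.

(** The vertex set of the upper factor determines both factors, by restriction to it and to its
    complement. *)
Lemma heap_mulI_positions U V U' V' : sqf (heap_mul U V) ->
  positions V = positions V' -> heap_mul U V = heap_mul U' V' ->
  U = U' /\ V = V'.
Proof.
move=> um eqV e; have um' : sqf (heap_mul U' V') by rewrite -e.
have sub (W W' : heap adj) : sqf (heap_mul W W') ->
    positions W \subset ~: positions W'.
  by rewrite sqf_mul disjoints_subset => /and3P[].
split.
  rewrite -(@res_mull (~: positions V) U V) ?setCK //; last exact: sub.
  by rewrite e eqV res_mull ?setCK //; apply: sub.
rewrite -(@res_mulr (positions V) U V) //; last exact: sub.
by rewrite e eqV res_mulr //; apply: sub.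
Qed.

(** * Pyramids and Lyndon heaps *)

(** Only the other pieces are constrained; minimality of the base itself follows by
    [pyramid_base_min]. *)
Definition pyramid (a : I) E : bool :=
  [&& sqf E, a \in positions E
    & [forall x in positions E, (x != a) ==> [exists y, harc E y x]]].

Lemma pyramidP a E : reflect
  [/\ sqf E, a \in positions E
    & forall x, x \in positions E -> x != a -> exists y, harc E y x]
  (pyramid a E).
Proof.
apply: (iffP and3P) => -[uE aE H]; split=> //.
  by move=> x xE xa; apply/existsP; apply: (implyP (forall_inP H x xE)).
by apply/forall_inP => x xE; apply/implyP => xa; apply/existsP/H.
Qed.

(** Descending along arcs lowers the rank, so the descent from any piece ends at the base. *)
Lemma pyramid_ind (Q : I -> Prop) a E : pyramid a E -> Q a ->
  (forall x y, harc E y x -> Q y -> Q x) -> forall x, x \in positions E -> Q x.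
Proof.
move=> /pyramidP[_ _ H] Qa step x.
have [n] := ubnP (rank E x); elim: n x => // n IH x lt xE.
have [->|xa] := eqVneq x a; first by [].
have [y yx] := H x xE xa; apply: (step x y yx).
by apply: IH (harc_posl yx); apply: leq_trans (harc_rank yx) _.
Qed.

Lemma pyramid_base_min a E y : pyramid a E -> ~~ harc E y a.
Proof.
move=> pE; apply/negP => ya.
have : rank E a <= rank E y.
  apply: (@pyramid_ind (fun y => rank E a <= rank E y) a E pE (leqnn _)).
    by move=> u v /harc_rank h h'; apply: leq_trans h' (ltnW h).
  exact: harc_posl ya.
by rewrite leqNgt (harc_rank ya).
Qed.

(* Moving U from the bottom of U o V to its top reverses exactly the arcs from
   U to V, so a potential equal to 1 on U and 0 on V records the change; the
   potentials of successive moves add up. *)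
Lemma conjugate_potential E F : conjugate E F -> sqf E ->
  [/\ sqf F, positions F = positions E
    & exists h : I -> int, forall x y, adj x y ->
        x \in positions E -> y \in positions E ->
        (h x - h y = Posz (harc E x y) - Posz (harc F x y))%R].
Proof.
elim=> {E F} [_ _ [U [V [-> ->]]] uE|E F G _ IH1 _ IH2 uE]; last first.
  have [uF pF [h hE]] := IH1 uE; have [uG pG [k kE]] := IH2 uF.
  split=> //; first by rewrite pG pF.
  exists (fun x => h x + k x)%R => x y Axy xE yE.
  have := hE x y Axy xE yE; rewrite -pF in xE yE.
  by have := kE x y Axy xE yE; lia.
have uF : sqf (heap_mul V U).
  by move: uE; rewrite !sqf_mul disjoint_sym => /and3P[-> ->].
split=> //; first by rewrite !positions_mul setUC.
exists (fun x => Posz (x \in positions U)) => x y Axy.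
rewrite !harc_mul // !mem_mul Axy /=.
have := uE; rewrite sqf_mul => /and3P[_ _ /pred0P dis].
have := dis x; have := dis y; rewrite /= => dy dx.
case Uxy: (harc U x y).
  by rewrite (harc_posl Uxy) (harc_posr Uxy) /= orbT.
case Vxy: (harc V x y).
  move: dx dy; rewrite (harc_posl Vxy) (harc_posr Vxy) !andbT => -> ->.
  by move=> _ _ /=; lia.
move: dx dy; case: (x \in positions U); case: (x \in positions V);
  case: (y \in positions U); case: (y \in positions V) => //=; lia.
Qed.

(** The potential [h] never increases along the arcs of [E] and never decreases along those of [F].
    Every piece is reached from [a] in both heaps, so [h] is constant and the arcs agree. *)
Lemma conjugate_pyramid_eq a E F :
  conjugate E F -> pyramid a E -> pyramid a F -> E = F.
Proof.
move=> cEF pyE pyF; have /pyramidP[uE aE _] := pyE.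
have [uF pF [h hE]] := conjugate_potential cEF uE.
have le1 x : x \in positions E -> (h x <= h a)%R.
  move: x; apply: (pyramid_ind pyE) => // x y yx; apply: le_trans.
  have := hE y x (harc_adj yx) (harc_posl yx) (harc_posr yx).
  by rewrite yx; case: (harc F y x); lia.
have le2 x : x \in positions E -> (h a <= h x)%R.
  rewrite -pF; move: x; apply: (pyramid_ind pyF) => // x y yx h1.
  apply: le_trans h1 _.
  have := harc_posl yx; have := harc_posr yx; rewrite pF => xE yE.
  have := hE y x (harc_adj yx) yE xE.
  by rewrite yx; case: (harc E y x); lia.
apply: heap_ext => // x y xy.
have xE := harc_posl xy; have yE := harc_posr xy.
have := hE x y (harc_adj xy) xE yE; rewrite xy.
have := le1 x xE; have := le2 x xE; have := le1 y yE; have := le2 y yE.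
by case: (harc F x y) => //; lia.
Qed.

Lemma conjugate_refl E : conjugate E E.
Proof.
apply: t_step; exists E, (heap_nil adj).
by rewrite heap_mulr1 heap_mul1.
Qed.

Definition connected_set S : Prop := forall A,
  (exists2 x, x \in S & x \in A) -> (exists2 x, x \in S & x \notin A) ->
  exists x y, [/\ x \in S :&: A, y \in S :\: A & adj x y].

(** A cut of the vertex set crossed by no edge splits [E] into two nonempty factors that commute. *)
Lemma primitive_connected E : sqf E -> primitive E ->
  connected_set (positions E).
Proof.
move=> uE prE A [x xE xA] [y yE yA]; apply: contrapT => nex.
have nadj u v : u \in positions E -> v \in positions E -> u \in A -> v \notin A ->
    ~~ adj u v.
  move=> uE' vE uA vA; apply/negP => Auv; apply: nex; exists u, v.
  by rewrite in_setI in_setD uE' uA vE vA.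
have e1 : E = heap_mul (res A E) (res (~: A) E).
  rewrite heap_split // => u v uv vA; apply: contraT => uA.
  have := nadj v u (harc_posr uv) (harc_posl uv) vA uA.
  by rewrite adj_sym (harc_adj uv).
have e2 : E = heap_mul (res (~: A) E) (res A E).
  have := @heap_split (~: A) E uE; rewrite setCK => -> //.
  move=> u v uv; rewrite !in_setC => vA; apply/negP => uA.
  have := nadj u v (harc_posl uv) (harc_posr uv) uA vA.
  by rewrite (harc_adj uv).
case: (prE _ _ e1 e2) => /(congr1 (@positions _ _ _)); rewrite positions_nil positions_res.
  by move/setP/(_ x); rewrite in_setI xE xA in_set0.
by move/setP/(_ y); rewrite in_setI in_setC yE yA in_set0.
Qed.

Definition upset a E : {set I} := [set x | connect (harc E) a x].

Lemma upset_positions a E : a \in positions E -> upset a E \subset positions E.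
Proof.
move=> aE; apply/subsetP => x; rewrite inE => /connectP[p pp ->].
elim/last_ind: p pp => //= p y _; rewrite rcons_path last_rcons => /andP[_].
exact: harc_posr.
Qed.

Lemma upset_closed a E x y : harc E x y -> x \in upset a E -> y \in upset a E.
Proof. by move=> xy; rewrite !inE => ax; apply: connect_trans ax (connect1 xy). Qed.

Lemma upset_base a E : a \in upset a E.
Proof. by rewrite inE connect0. Qed.

Lemma upset_pred a E x : x \in upset a E -> x != a ->
  exists2 y, y \in upset a E & harc E y x.
Proof.
rewrite inE => /connectP[p]; elim/last_ind: p => [_ /= ->|p y _].
  by rewrite eqxx.
rewrite rcons_path last_rcons => /andP[pp yx] -> _; exists (last a p) => //.
by rewrite inE; apply/connectP; exists p.
Qed.

Lemma pyramid_upset a E : sqf E -> a \in positions E ->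
  pyramid a (res (upset a E) E).
Proof.
move=> uE aE; apply/pyramidP; split; first exact: sqf_res.
  by rewrite positions_res in_setI aE upset_base.
move=> x; rewrite positions_res in_setI => /andP[xE xu] xa.
have [y yu yx] := upset_pred xu xa; exists y.
by rewrite harc_res // yu xu.
Qed.

Lemma upset_pyramid a E : pyramid a E -> upset a E = positions E.
Proof.
move=> pyE; have /pyramidP[_ aE _] := pyE.
apply/eqP; rewrite eqEsubset upset_positions //=; apply/subsetP.
apply: (pyramid_ind pyE); first exact: upset_base.
by move=> x y; apply: upset_closed.
Qed.

Lemma upset_split a E : sqf E ->
  heap_mul (res (~: upset a E) E) (res (upset a E) E) = E.
Proof.
move=> uE; rewrite -{2}[upset a E]setCK; apply: heap_split => // x y xy.
by rewrite !in_setC; apply: contra; apply: upset_closed.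
Qed.

(** Arcs never lead from the upper factor [V] back down to [U], and inside [V] everything lies above
    [a]. *)
Lemma upset_mul a U V : sqf (heap_mul U V) -> pyramid a V ->
  upset a (heap_mul U V) = positions V.
Proof.
move=> um pV; have := um; rewrite sqf_mul => /and3P[_ _ /pred0P dis].
apply/eqP; rewrite eqEsubset; apply/andP; split; apply/subsetP => x; last first.
  rewrite -(upset_pyramid pV) !inE; apply: connect_sub => u v uv.
  by apply: connect1; rewrite harc_mul // uv orbT.
rewrite inE => /connectP[p pp ->]; elim/last_ind: p pp => [_|p y IH] /=.
  by case/pyramidP: pV.
rewrite rcons_path last_rcons => /andP[/IH lV].
have := dis (last a p); rewrite /= lV andbT => lU.
by rewrite harc_mul // lU /= andbF orbF => /orP[/harc_posl|/harc_posr//]; rewrite lU.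
Qed.

(** Induction on the number of pieces not above [a]. If there are any, connectedness gives an edge
    from some [x] above [a] to some [y] that is not. Moving the up-set of [a] to the bottom keeps
    the arcs inside it and puts [y] above [x], so the up-set grows. *)
Lemma conjugate_to_pyramid a E : sqf E -> a \in positions E ->
  connected_set (positions E) -> exists2 F, conjugate E F & pyramid a F.
Proof.
have [n] := ubnP #|~: upset a E|; elim: n E => // n IH E lt uE aE con.
have [sub|] := boolP (positions E \subset upset a E).
  exists E; first exact: conjugate_refl.
  apply/pyramidP; split=> // x xE xa.
  by have [y _ yx] := upset_pred (subsetP sub x xE) xa; exists y.
move=> /subsetPn[z zE zu].
have [x [y [xS yS Axy]]] := con (upset a E)
  (ex_intro2 _ _ a aE (upset_base a E)) (ex_intro2 _ _ z zE zu).
pose F := heap_mul (res (upset a E) E) (res (~: upset a E) E).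
have cEF : conjugate E F.
  apply: t_step; exists (res (~: upset a E) E), (res (upset a E) E).
  by rewrite upset_split.
have [uF pF _] := conjugate_potential cEF uE.
have subF : upset a E \subset upset a F.
  apply/subsetP => t; rewrite 2!inE => /connectP[p pp ->].
  elim/last_ind: p pp => //= p t' IHp; rewrite rcons_path last_rcons.
  move=> /andP[pp lt']; apply: connect_trans (IHp pp) (connect1 _).
  have lu : last a p \in upset a E by rewrite inE; apply/connectP; exists p.
  by rewrite harc_mul // harc_res // lu (upset_closed lt' lu) lt'.
have yF : y \in upset a F.
  move: xS yS; rewrite in_setI in_setD => /andP[xE xu] /andP[yu yE].
  apply: (upset_closed _ (subsetP subF x xu)).
  by rewrite harc_mul // Axy !positions_res !in_setI in_setC xE xu yE yu !orbT.
have [||||G cFG pG] := IH F; rewrite ?pF //; last first.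
  by exists G => //; apply: t_trans cEF cFG.
apply: leq_trans (_ : #|~: upset a E| <= n); last by rewrite -ltnS.
apply: proper_card; apply/properP; split; first by rewrite setCS.
exists y; rewrite in_setC ?yF //.
by move: yS; rewrite in_setD => /andP[].
Qed.

(** Suppose the base lies in [U]. In [V] placed below [U], a piece of [V] has predecessors only in
    [V]; the piece of [V] of least rank then has none, yet it is not the base. *)
Lemma pyramid_primitive a E : pyramid a E -> primitive E.
Proof.
move=> pyE U V; have /pyramidP[uE aE pE] := pyE.
wlog aU : U V / a \in positions U.
  move=> wl eUV eVU; have := aE; rewrite {1}eUV mem_mul => /orP[aU|aV].
    exact: wl.
  by have [->|->] := wl V U aV eVU eUV; [right|left].
move=> eUV eVU; right; apply: positions_eq0; apply/eqP.
have um : sqf (heap_mul V U) by rewrite -eVU.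
have := um; rewrite sqf_mul => /and3P[_ _ /pred0P dis].
apply: contraT => /set0Pn[x0 x0V].
case: (arg_minnP (rank E) x0V) => x xV0 xmin.
have xV : x \in positions V := xV0.
have xE : x \in positions E by rewrite eVU mem_mul xV.
have [xa|xa] := eqVneq x a.
  by have := dis a; rewrite /= aU -xa xV.
have [y yx] := pE x xE xa; have := yx; rewrite {1}eVU harc_mul //.
have xU : (x \in positions U) = false by have := dis x; rewrite /= xV.
case/or3P => [/harc_posl yV|/harc_posr|/and3P[_ _]]; rewrite ?xU //.
by have := xmin y yV; rewrite leqNgt (harc_rank yx).
Qed.

(** The first letter of a word has no predecessor, so it can only be the base. *)
Lemma pyramid_head a E w : pyramid a E -> heap_of w = E ->
  exists w', w = a :: w'.
Proof.
move=> /pyramidP[uE aE pE] wE; have uw : uniq w by rewrite -(sqf_heap_of) wE.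
case: w uw wE => [|b w] uw wE.
  by move: aE; rewrite -wE mem_heap_of.
exists w; congr (_ :: _); apply/eqP; apply: contraT => ba.
have bE : b \in positions E by rewrite -wE mem_heap_of mem_head.
have [y] := pE b bE ba; rewrite -wE harc_heap_of // => /and4P[_ _ _].
by rewrite /= eqxx.
Qed.

(** Some minimal piece [b] differs from [a], and a minimal piece can be written first. *)
Lemma not_pyramid_head a E : sqf E -> a \in positions E -> ~~ pyramid a E ->
  exists b w, [/\ b \in positions E, b != a & E = heap_of (b :: w)].
Proof.
move=> uE aE npy; have [b] : exists b,
    [/\ b \in positions E, b != a & forall y, ~~ harc E y b].
  apply: contrapT => nex; move/negP: npy; apply; apply/pyramidP; split=> // x xE xa.
  apply: contrapT => ny; apply: nex; exists x; split=> // y.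
  by apply/negP => yx; apply: ny; exists y.
case=> bE ba nb; exists b, (repr (res (~: [set b]) E)); split => //.
rewrite -cat1s -heap_mul_of heap_ofK.
suff -> : heap_of [:: b] = res [set b] E.
  rewrite heap_split // => x y xy; rewrite !in_set1 => /eqP yb.
  by have := nb x; rewrite -yb xy.
apply: heap_ext; rewrite ?sqf_heap_of ?filter_uniq //.
  apply/setP => x; rewrite positions_res mem_heap_of in_setI mem_seq1 in_set1.
  by case: eqP => [->|]; rewrite ?bE ?andbF.
by move=> x y; rewrite harc_heap_of // => /and4P[_]; rewrite !inE => /eqP-> /eqP->; rewrite ltnn.
Qed.

Lemma pyramid_heap_le a b E F : pyramid a E -> pyramid b F ->
  (heap_le E F -> (a <= b)%O) /\ ((a < b)%O -> heap_le E F).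
Proof.
move=> pE pF; rewrite /heap_le.
have [w ->] := pyramid_head pE (stP E).1.
have [w' ->] := pyramid_head pF (stP F).1.
rewrite Order.SeqLexiOrder.Exports.lexi_cons; split; first by case/andP.
by move=> ab; rewrite (ltW ab) /= leNgt ab.
Qed.

(** Here it matters that [st] is the largest word: [F] has a word starting with some [b > a], so
    [st F] is at least that word, while [st E] starts with [a]. *)
Lemma pyramid_heap_lt a E F : pyramid a E -> sqf F -> ~~ pyramid a F ->
  positions F = positions E -> (forall x, x \in positions E -> (a <= x)%O) ->
  (st E < st F)%O.
Proof.
move=> pE uF npF pFE amin; have /pyramidP[uE aE _] := pE.
have aF : a \in positions F by rewrite pFE.
have [b [w [bF ba wF]]] := not_pyramid_head uF aF npF.
apply: lt_le_trans (_ : ((b :: w : seqlexi I) <= st F)%O); last first.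
  by apply: (stP F).2.
have [w' ->] := pyramid_head pE (stP E).1.
rewrite Order.SeqLexiOrder.Exports.ltxi_cons.
have lt : (a < b)%O by rewrite lt_neqAle eq_sym ba amin // -pFE.
by rewrite (ltW lt) /= leNgt lt.
Qed.

(** A Lyndon heap is connected, hence conjugate to a pyramid based at its minimum, which would be
    strictly smaller if the heap were not such a pyramid itself. Conversely, a conjugate of the
    pyramid [E] is either [E] or a non-pyramid, and the latter is larger. *)
Lemma lyndonP E : sqf E ->
  lyndon E <->
  exists2 a, pyramid a E & forall x, x \in positions E -> (a <= x)%O.
Proof.
move=> uE; split=> [[nE prE minE]|[a pE amin]].
  have [E0|[x0 x0E]] := set_0Vmem (positions E).
    by case: nE; apply: positions_eq0.
  pose a := [arg min_(a < x0 in positions E) a]%O.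
  have [aE amin] : a \in positions E /\ forall x, x \in positions E -> (a <= x)%O.
    by rewrite /a; case: Order.TotalTheory.arg_minP.
  exists a => //; apply: contraT => npy.
  have [F cEF pF] := conjugate_to_pyramid uE aE (primitive_connected uE prE).
  have [uF pFE _] := conjugate_potential cEF uE.
  have := pyramid_heap_lt pF uE npy (esym pFE) _.
  rewrite pFE => /(_ amin); rewrite ltNge; have := minE F cEF.
  by rewrite /heap_le => ->.
have /pyramidP[_ aE _] := pE; split.
- by move=> E0; rewrite E0 positions_nil in_set0 in aE.
- exact: pyramid_primitive pE.
move=> F cEF; have [uF pFE _] := conjugate_potential cEF uE.
have [pF|npF] := boolP (pyramid a F).
  by rewrite (conjugate_pyramid_eq cEF pE pF) /heap_le.
exact/ltW/(pyramid_heap_lt pE).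
Qed.

Local Notation hprod := (foldr (@heap_mul d I adj) (heap_nil adj)).

(** * Lyndon factorizations of square-free heaps *)

Lemma hprod_rcons s V : hprod (rcons s V) = heap_mul (hprod s) V.
Proof.
elim: s => /= [|F s ->]; last by rewrite heap_mulA.
by rewrite heap_mul1 heap_mulr1.
Qed.

Lemma positions_hprod s x :
  (x \in positions (hprod s)) = has (fun F => x \in positions F) s.
Proof. by elim: s => [|F s IH] /=; rewrite ?positions_nil ?in_set0 // mem_mul IH. Qed.

Lemma sqf_hprod s F : sqf (hprod s) -> F \in s -> sqf F.
Proof.
elim: s => //= G s IH; rewrite sqf_mul => /and3P[uG us _].
by rewrite inE => /orP[/eqP->|/IH->].
Qed.

Lemma heap_le_trans : transitive (fun E F => heap_le F E).
Proof. by move=> F E G FE GF; apply: le_trans GF FE. Qed.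

(** The factors decrease and are pyramids based at their minima, so the base of the last factor is
    at most every other base. It is therefore the minimum [a] of [E], and the last factor is
    everything above [a]. *)
Lemma lyndon_factorization_rcons a E Es :
    sqf E -> a \in positions E -> (forall x, x \in positions E -> (a <= x)%O) ->
  lyndon_factorization E Es ->
  exists2 Es', Es = rcons Es' (res (upset a E) E)
             & lyndon_factorization (res (~: upset a E) E) Es'.
Proof.
move=> uE aE amin [eE lynE].
rewrite (sorted_pairwise heap_le_trans).
case/lastP: Es eE lynE => [|Es V] eE lynE.
  by move: aE; rewrite eE positions_nil in_set0.
rewrite pairwise_rcons => /andP[/allP leV sEs].
have uP := uE; rewrite eE in uP.
have pyr F : F \in rcons Es V ->
    exists2 b, pyramid b F & forall x, x \in positions F -> (b <= x)%O.
  by move=> FE; apply: (lyndonP (sqf_hprod uP FE)).1; apply: lynE.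
have [b pV bmin] : exists2 b, pyramid b V & forall x, x \in positions V -> (b <= x)%O.
  by apply: pyr; rewrite mem_rcons mem_head.
have /pyramidP[_ bV _] := pV.
have ba : b = a.
  apply/le_anti; rewrite [(a <= b)%O]amin; last first.
    by rewrite eE hprod_rcons mem_mul bV orbT.
  rewrite andbT; move: aE; rewrite eE positions_hprod => /hasP[F FE aF].
  have [c pF cmin] := pyr F FE; apply: le_trans (cmin a aF).
  apply: (pyramid_heap_le pV pF).1.
  move: FE; rewrite mem_rcons inE => /orP[/eqP->|/leV//]; exact: lexx.
rewrite ba in pV; rewrite hprod_rcons in eE uP.
have upE : upset a E = positions V by rewrite eE upset_mul.
have dis : positions (hprod Es) \subset ~: positions V.
  by move: uP; rewrite sqf_mul disjoints_subset => /and3P[].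
exists Es; first by rewrite upE eE res_mulr.
split.
- by rewrite upE eE res_mull ?setCK.
- by move=> F FE; apply: lynE; rewrite mem_rcons inE FE orbT.
- by rewrite (sorted_pairwise heap_le_trans).
Qed.

(** The base of each earlier factor lies outside the up-set of [a], hence exceeds [a], and first
    letters decide the order. *)
Lemma rcons_lyndon_factorization a E Es :
    sqf E -> a \in positions E -> (forall x, x \in positions E -> (a <= x)%O) ->
  lyndon_factorization (res (~: upset a E) E) Es ->
  lyndon_factorization E (rcons Es (res (upset a E) E)).
Proof.
move=> uE aE amin [eU lynU]; rewrite (sorted_pairwise heap_le_trans) => sU.
have pV := pyramid_upset uE aE.
have uU : sqf (hprod Es) by rewrite -eU sqf_res.
split; first by rewrite hprod_rcons -eU upset_split.
- move=> F; rewrite mem_rcons inE => /orP[/eqP->|/lynU//].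
  apply/(lyndonP); first exact: sqf_res.
  by exists a => // x; rewrite positions_res in_setI => /andP[/amin].
- rewrite (sorted_pairwise heap_le_trans) pairwise_rcons sU andbT.
  apply/allP => F FE; have uF := sqf_hprod uU FE.
  have [c pF cmin] := (lyndonP uF).1 (lynU F FE).
  apply: (pyramid_heap_le pV pF).2.
  have /pyramidP[_ cF _] := pF.
  have : c \in positions (res (~: upset a E) E).
    by rewrite eU positions_hprod; apply/hasP; exists F.
  rewrite positions_res in_setI in_setC => /andP[cE cu].
  rewrite lt_neqAle amin // andbT; apply: contraNneq cu => <-.
  exact: upset_base.
Qed.

Lemma exists_min_position E : E <> heap_nil adj ->
  exists2 a, a \in positions E & forall x, x \in positions E -> (a <= x)%O.
Proof.
move=> nE; have [E0|[x0 x0E]] := set_0Vmem (positions E).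
  by case: nE; apply: positions_eq0.
exists [arg min_(a < x0 in positions E) a]%O; by case: Order.TotalTheory.arg_minP.
Qed.

Lemma card_res_upset a E : a \in positions E ->
  #|positions (res (~: upset a E) E)| < #|positions E|.
Proof.
move=> aE; apply: proper_card; rewrite positions_res; apply/properP.
split; first exact: subsetIl.
by exists a => //; rewrite in_setI in_setC upset_base andbF.
Qed.

Lemma lyndon_factorization_ex E : sqf E -> exists Es, lyndon_factorization E Es.
Proof.
have [n] := ubnP #|positions E|; elim: n E => // n IH E lt uE.
have [->|/exists_min_position[a aE amin]] := pselect (E = heap_nil adj).
  by exists [::].
have [||Es fEs] := IH (res (~: upset a E) E).
- exact: leq_trans (card_res_upset aE) _.
- exact: sqf_res.
by exists (rcons Es (res (upset a E) E)); apply: rcons_lyndon_factorization.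
Qed.

Lemma lyndon_factorization_nil Es :
  lyndon_factorization (heap_nil adj) Es -> Es = [::].
Proof.
case: Es => // F Es [e lynE _].
have [nF _ _] : lyndon F by apply: lynE; rewrite mem_head.
have [F0|[x xF]] := set_0Vmem (positions F).
  by case: nF; apply: positions_eq0.
have : x \in positions (heap_nil adj) by rewrite e mem_mul xF.
by rewrite positions_nil in_set0.
Qed.

Lemma lyndon_factorization_uniq E Es Fs : sqf E ->
  lyndon_factorization E Es -> lyndon_factorization E Fs -> Es = Fs.
Proof.
have [n] := ubnP #|positions E|; elim: n E Es Fs => // n IH E Es Fs lt uE.
have [->|/exists_min_position[a aE amin]] := pselect (E = heap_nil adj).
  by move=> /lyndon_factorization_nil-> /lyndon_factorization_nil->.
move=> /(lyndon_factorization_rcons uE aE amin)[Es' -> fE].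
move=> /(lyndon_factorization_rcons uE aE amin)[Fs' -> fF].
congr rcons; apply: IH fE fF; last exact: sqf_res.
exact: leq_trans (card_res_upset aE) _.
Qed.

(** The default [[::]] is never taken for a square-free heap, by [factorsP]. *)
Definition factors E : seq (heap adj) :=
  xget [::] [set Es | lyndon_factorization E Es]%classic.

Lemma factorsP E : sqf E -> lyndon_factorization E (factors E).
Proof.
by move=> /lyndon_factorization_ex[Es fEs]; rewrite /factors; case: xgetP => // /(_ Es).
Qed.

Lemma size_factors_rec a E :
    sqf E -> a \in positions E -> (forall x, x \in positions E -> (a <= x)%O) ->
  size (factors E) = (size (factors (res (~: upset a E) E))).+1.
Proof.
move=> uE aE amin.
have [Es' -> f'] := lyndon_factorization_rcons uE aE amin (factorsP uE).
rewrite size_rcons; congr _.+1; congr size.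
by apply: (lyndon_factorization_uniq _ f'); [|apply: factorsP]; apply: sqf_res.
Qed.

Lemma size_factors_nil : size (factors (heap_nil adj)) = 0.
Proof.
suff /factorsP/lyndon_factorization_nil -> : sqf (heap_nil adj) by [].
by rewrite sqf_heap_of.
Qed.

(** * The generating polynomial of the number of Lyndon factors *)

Definition heaps_on S : seq (heap adj) :=
  undup [seq heap_of w | w <- permutations (enum S)].

Lemma heaps_on_uniq S : uniq (heaps_on S).
Proof. exact: undup_uniq. Qed.

Lemma mem_heaps_on S E : (E \in heaps_on S) = sqf E && (positions E == S).
Proof.
rewrite mem_undup; apply/mapP/andP => [[w]|[uE /eqP pE]].
  rewrite mem_permutations => pw ->; rewrite sqf_heap_of (perm_uniq pw) enum_uniq.
  split=> //; apply/eqP/setP => x.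
  by rewrite mem_heap_of (perm_mem pw) mem_enum.
exists (repr E); last by rewrite heap_ofK.
rewrite mem_permutations; apply: uniq_perm; rewrite ?enum_uniq //.
by move=> x; rewrite mem_enum -pE mem_positions.
Qed.

Definition pyramids (a : I) S : seq (heap adj) :=
  [seq E <- heaps_on S | pyramid a E].

Lemma mem_pyramids a S E :
  (E \in pyramids a S) = pyramid a E && (positions E == S).
Proof.
rewrite mem_filter mem_heaps_on; case pE: (pyramid a E) => //=.
by case/pyramidP: pE => ->.
Qed.

Lemma heap_mul_disjoint S (V : {set I}) U F :
    U \in heaps_on (S :\: V) -> sqf F -> positions F = V ->
  sqf (heap_mul U F) /\ res (~: V) (heap_mul U F) = U.
Proof.
rewrite mem_heaps_on => /andP[uU /eqP pU] uF pF.
have sub : positions U \subset ~: V.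
  by rewrite pU; apply/subsetP => x; rewrite !inE => /andP[].
have um : sqf (heap_mul U F) by rewrite sqf_mul uU uF disjoints_subset pF.
by split=> //; rewrite res_mull ?setCK // pF.
Qed.

(** The bijection behind the recursion for [heap_sum]: cut [E] into the part not above [a] and the
    pyramid above [a]. Both lists are empty when [a] is not in [V]. *)
Lemma upset_fibre a S (V : {set I}) : V \subset S ->
  perm_eq [seq E <- heaps_on S | (a \in V) && (upset a E == V)]
          [seq heap_mul U F | U <- heaps_on (S :\: V), F <- pyramids a V].
Proof.
move=> VS; have disj U F : U \in heaps_on (S :\: V) -> F \in pyramids a V ->
    sqf (heap_mul U F).
  rewrite mem_pyramids => Um /andP[/pyramidP[uF _ _] /eqP pF].
  by have [] := heap_mul_disjoint Um uF pF.
apply: uniq_perm.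
- exact/filter_uniq/heaps_on_uniq.
- apply: allpairs_uniq; [exact: heaps_on_uniq|exact/filter_uniq/heaps_on_uniq|].
  move=> [U F] [U' F'] /= /allpairsP[[U1 F1] /= [U1m F1m [-> ->]]].
  move=> /allpairsP[[U2 F2] /= [U2m F2m [-> ->]]] e.
  have pF1 : positions F1 = V by move: F1m; rewrite mem_pyramids => /andP[_ /eqP].
  have pF2 : positions F2 = V by move: F2m; rewrite mem_pyramids => /andP[_ /eqP].
  have [|-> -> //] := heap_mulI_positions (disj _ _ U1m F1m) _ e.
  by rewrite pF1 pF2.
move=> E; rewrite mem_filter mem_heaps_on; apply/idP/allpairsP.
  move=> /and3P[/andP[aV /eqP up] uE /eqP pE].
  exists (res (~: V) E, res V E) => /=; split.
  - by rewrite mem_heaps_on sqf_res // positions_res pE setDE eqxx.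
  - have aE : a \in positions E by rewrite pE (subsetP VS).
    have := pyramid_upset uE aE; rewrite up mem_pyramids positions_res pE => -> /=.
    exact/eqP/setIidPr.
  - by rewrite -up upset_split.
move=> [[U F] /= [Um Fm ->]]; have um := disj U F Um Fm.
move: Um Fm; rewrite mem_heaps_on mem_pyramids => /andP[uU /eqP pU] /andP[pyF /eqP pF].
have /pyramidP[_ aF _] := pyF.
rewrite um upset_mul // positions_mul pU pF -pF aF eqxx /= pF.
by rewrite -{2}(setIidPr VS) setUC setID.
Qed.

(** The value of the polynomial P_S at an integer [y]. *)
Definition heap_sum S (y : int) : int :=
  (\sum_(E <- heaps_on S) y ^+ size (factors E))%R.

Lemma heap_sum_rec a S (y : int) : a \in S ->
    (forall x, x \in S -> (a <= x)%O) ->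
  heap_sum S y = (y * \sum_(V : {set I} | (V \subset S) && (a \in V))
    (size (pyramids a V))%:R * heap_sum (S :\: V) y)%R.
Proof.
move=> aS amin; rewrite /heap_sum mulr_sumr.
rewrite big_seq_cond.
rewrite (partition_big (fun E => upset a E)
  (fun V : {set I} => (V \subset S) && (a \in V))) /=; last first.
  move=> E; rewrite andbT mem_heaps_on => /andP[uE /eqP pE].
  by rewrite upset_base andbT -pE upset_positions // pE.
apply: eq_bigr => V /andP[VS aV].
transitivity (\sum_(E <- [seq E <- heaps_on S | (a \in V) && (upset a E == V)])
   y * y ^+ size (factors (res (~: V) E)))%R.
  rewrite big_filter aV /= [RHS]big_seq_cond; apply: eq_big => E.
    by rewrite andbT.
  rewrite andbT => /andP[]; rewrite mem_heaps_on => /andP[uE /eqP pE] /eqP upE.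
  by rewrite (@size_factors_rec a) ?pE // upE exprS.
rewrite (perm_big _ (upset_fibre a VS)) /= big_allpairs_dep /= !mulr_sumr.
rewrite big_seq_cond [RHS]big_seq_cond; apply: eq_bigr => U; rewrite andbT => Um.
transitivity (\sum_(F <- pyramids a V) y * y ^+ size (factors U))%R.
  rewrite big_seq_cond [RHS]big_seq_cond; apply: eq_bigr => F; rewrite andbT.
  rewrite mem_pyramids => /andP[/pyramidP[uF _ _] /eqP pF].
  by have [_ ->] := heap_mul_disjoint Um uF pF.
by rewrite big_const_seq count_predT iter_addr_0 mulrCA mulr_natl.
Qed.

Lemma heap_sum_nil (y : int) : heap_sum set0 y = 1%R.
Proof.
rewrite /heap_sum (perm_big [:: heap_nil adj]).
  by rewrite big_seq1 size_factors_nil.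
apply: uniq_perm; rewrite ?heaps_on_uniq // => E.
rewrite mem_heaps_on inE; apply/andP/eqP => [[_ /eqP/positions_eq0]//|->].
by rewrite sqf_heap_of positions_nil.
Qed.

(** * Stable top layers and the shift from y to y - 1 *)

Definition sinks (T : {set I}) E : bool :=
  [forall x in T, forall y, ~~ harc E x y].

Lemma sinksP (T : {set I}) E :
  reflect (forall x y, x \in T -> ~~ harc E x y) (sinks T E).
Proof.
apply: (iffP forall_inP) => H x; first by move=> y xT; apply: (forallP (H x xT)).
by move=> xT; apply/forallP => y; apply: H.
Qed.

Lemma stableP (T : {set I}) :
  reflect {in T &, forall x y, ~~ adj x y} (stable adj T).
Proof.
apply: (iffP forall_inP) => H x; first by move=> y xT yT; apply: (forall_inP (H x xT)).
by move=> xT; apply/forall_inP => y; apply: H.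
Qed.

Lemma stable_harc (T : {set I}) E x y : stable adj T -> positions E = T ->
  harc E x y = false.
Proof.
move=> /stableP stT pE; apply/negP => xy; move: (harc_adj xy); apply/negP.
by apply: stT; rewrite -pE; [apply: harc_posl xy|apply: harc_posr xy].
Qed.

(** A heap on a stable set has no arcs, so [heap_of (enum T)] is the only one on [T]; a set of sinks
    can be split off at the top. *)
Lemma sinks_fibre a S (T : {set I}) : T \subset S -> stable adj T ->
  perm_eq [seq heap_mul F (heap_of (enum T)) | F <- pyramids a (S :\: T)]
          [seq E <- heaps_on S | sinks T E && pyramid a (res (~: T) E)].
Proof.
move=> TS stT; pose Q := heap_of (enum T).
have uQ : sqf Q by rewrite sqf_heap_of enum_uniq.
have pQ : positions Q = T by apply/setP => x; rewrite mem_heap_of mem_enum.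
have mulQ F : F \in pyramids a (S :\: T) ->
    sqf (heap_mul F Q) /\ res (~: T) (heap_mul F Q) = F.
  rewrite mem_filter => /andP[_ Fm]; exact: heap_mul_disjoint Fm uQ pQ.
apply: uniq_perm; last 1 first.
- move=> E; rewrite mem_filter mem_heaps_on; apply/mapP/idP => [[F Fm ->]|].
    have [um rF] := mulQ F Fm; rewrite rF um.
    move: Fm; rewrite mem_pyramids => /andP[-> /eqP pF].
    have eST : S :\: T :|: T = S by rewrite -{2}(setIidPr TS) setUC setID.
    rewrite positions_mul pF pQ eST eqxx !andbT.
    apply/sinksP => x y xT; rewrite harc_mul // (stable_harc _ _ stT pQ) /=.
    apply/negP => /orP[/harc_posl|/and3P[_]]; by rewrite pF in_setD xT.
  move=> /andP[/andP[/sinksP sT pyE] /andP[uE /eqP pE]].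
  exists (res (~: T) E); first by rewrite mem_pyramids pyE positions_res pE setDE eqxx.
  rewrite -[LHS](@heap_split (~: T) E uE).
    rewrite setCK; congr heap_mul; apply: heap_ext; rewrite ?sqf_res //.
      by rewrite positions_res pE pQ; apply/setIidPr.
    by move=> x y; rewrite harc_res // => /and3P[xT _]; rewrite (negPf (sT x y xT)).
  by move=> x y xy _; rewrite in_setC; apply: contraL xy => xT; apply: sT.
- rewrite map_inj_in_uniq; first exact/filter_uniq/heaps_on_uniq.
  move=> F F' Fm Fm' e; have [_ <-] := mulQ F Fm; have [_ <-] := mulQ F' Fm'.
  by rewrite /Q e.
- exact/filter_uniq/heaps_on_uniq.
Qed.

Local Open Scope ring_scope.

(** Nothing lies above [z], so removing it deprives no piece of a predecessor. The piece [u] below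
    [z] is not a sink, so it stays outside [T] and supports [z] when [z] is put back. *)
Lemma sinks_setU1 a z (T : {set I}) E : sqf E -> z != a -> z \notin T ->
    (exists u, harc E u z) -> (forall y, ~~ harc E z y) ->
  sinks (z |: T) E && pyramid a (res (~: (z |: T)) E)
    = sinks T E && pyramid a (res (~: T) E).
Proof.
move=> uE za zT [u uz] zmax.
have sinksE : sinks (z |: T) E = sinks T E.
  apply/sinksP/sinksP => sT x y xT; first by apply: sT; rewrite in_setU1 xT orbT.
  by move: xT; rewrite in_setU1 => /orP[/eqP->|/sT].
rewrite sinksE; case: sinksP => //= sT.
have uT : u \notin T by apply/negP => uT; have := sT u z uT; rewrite uz.
apply/pyramidP/pyramidP => -[_]; rewrite !positions_res.
  rewrite !inE negb_or => /andP[aE /andP[_ aT]] pE; split; first exact: sqf_res.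
    by rewrite aE aT.
  move=> x; rewrite !inE => /andP[xE xT] xa.
  have [->|xz] := eqVneq x z.
    by exists u; rewrite harc_res // !in_setC uT zT.
  have [|y] := pE x _ xa; first by rewrite !inE negb_or xE xT xz.
  rewrite harc_res // !in_setC !in_setU1 !negb_or => /and3P[/andP[_ yT] _ yx].
  by exists y; rewrite harc_res // !in_setC yT xT yx.
rewrite !inE => /andP[aE aT] pE; split; first exact: sqf_res.
  by rewrite aE negb_or aT eq_sym za.
move=> x; rewrite !inE negb_or => /andP[xE /andP[xz xT]] xa.
have [|y] := pE x _ xa; first by rewrite !inE xE xT.
rewrite harc_res // => /and3P[yT _ yx]; exists y.
rewrite harc_res // yx !inE !negb_or xz xT; rewrite in_setC in yT; rewrite yT !andbT.
by apply: contraTneq yx => ->.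
Qed.

(* A maximal non-isolated piece z other than a can be moved freely between the
   stable top layer T and the pyramid below it: a sign-reversing involution. *)
Lemma sinks_sign_sum a S E : E \in heaps_on S -> ~~ stable adj S ->
  \sum_(T : {set I} | (T \subset S) && (sinks T E && pyramid a (res (~: T) E)))
    (-1) ^+ #|S :\: T| = 0 :> int.
Proof.
rewrite mem_heaps_on => /andP[uE /eqP pE] nst.
pose hit z := [exists u, harc E u z].
have [z0 z0hit] : exists z, hit z.
  apply: contrapT => nex; move/negP: nst; apply; apply/stableP => x y xS yS.
  apply/negP => Axy; rewrite -pE in xS yS.
  by case/orP: (harc_total Axy xS yS) => h; apply: nex;
    [exists y; apply/existsP; exists x|exists x; apply/existsP; exists y].
(* Among the pieces with something below them, one of largest rank has nothing above it. *)
case: (arg_maxnP (rank E) z0hit) => z /existsP zhit zrank.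
have zmax y : ~~ harc E z y.
  apply/negP => zy; have /zrank : hit y by apply/existsP; exists z.
  by rewrite /= leqNgt (harc_rank zy).
(* If [z] is [a], no [T] contributes: a piece [u] below [a] is not a sink, so it remains in the
   pyramid, underneath its base. *)
have [za|za] := eqVneq z a.
  apply: big_pred0 => T; apply/negP => /and3P[_ /sinksP sT pT].
  have [u uz] := zhit; rewrite za in uz.
  have /negP := pyramid_base_min u pT; apply; rewrite harc_res // uz andbT.
  apply/andP; split; first by rewrite in_setC; apply: contraL uz => /sT.
  by case/pyramidP: pT => _; rewrite positions_res in_setI => /andP[].
have zS : z \in S by have [u /harc_posr] := zhit; rewrite pE.
rewrite (bigID (fun T : {set I} => z \in T)) /=.
rewrite (reindex_onto (fun T => z |: T) (fun T => T :\ z)) /=; last first.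
  by move=> T /andP[_ zT]; rewrite finset.setD1K.
apply/eqP; rewrite addr_eq0 -sumrN; apply/eqP; apply: eq_big => T.
  rewrite setU11 andbT; have [zT|zT] := boolP (z \in T).
    rewrite andbF; apply/negbTE; apply/negP => /andP[_ /eqP/setP/(_ z)].
    by rewrite zT !inE eqxx.
  rewrite setU1K // eqxx !andbT subUset sub1set zS /=.
  by rewrite (sinks_setU1 uE za zT).
move=> /andP[_ /eqP eT].
have zT : z \notin T by rewrite -eT !inE eqxx.
have -> : S :\: T = z |: (S :\: (z |: T)).
  by apply/setP => x; rewrite !inE; case: eqP => [->|//] /=; rewrite zT zS.
by rewrite cardsU1 !inE eqxx /= exprS mulN1r opprK.
Qed.

Lemma pyramids_stable a (V : {set I}) : stable adj V ->
  size (pyramids a V) = (V == [set a]) :> nat.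
Proof.
move=> stV; case: eqP => [eV|nV]; last first.
  apply/eqP; rewrite size_eq0; apply/eqP.
  case e: (pyramids a V) => [//|E s]; case: nV.
  have : E \in pyramids a V by rewrite e mem_head.
  rewrite mem_pyramids => /andP[/pyramidP[uE aE H] /eqP pE].
  apply/setP => x; rewrite in_set1; apply/idP/eqP => [xV|->]; last by rewrite -pE.
  apply/eqP; apply: contraT => xa; rewrite -pE in xV; have [y] := H x xV xa.
  by rewrite (stable_harc _ _ stV pE).
have -> // : size (pyramids a V) = size [:: heap_of [:: a]].
apply: perm_size; apply: uniq_perm => //; first exact/filter_uniq/heaps_on_uniq.
have pa : positions (heap_of [:: a]) = [set a].
  by apply/setP => x; rewrite mem_heap_of mem_seq1 in_set1.
move=> E; rewrite mem_pyramids inE eV; apply/andP/eqP => [[pyE /eqP pE]|->].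
  have /pyramidP[uE _ _] := pyE.
  apply: heap_ext; rewrite ?sqf_heap_of ?pE ?pa // => x y.
  by rewrite (stable_harc _ _ stV) // pE eV.
rewrite pa eqxx; split=> //; apply/pyramidP; rewrite pa sqf_heap_of.
by split=> // [|x]; rewrite in_set1 // => ->.
Qed.

Lemma stable_subset (T S : {set I}) : T \subset S -> stable adj S -> stable adj T.
Proof.
move=> /subsetP TS /stableP stS; apply/stableP => x y xT yT.
by apply: stS; apply: TS.
Qed.

(** For stable [S] only the one-piece pyramid on [a] survives, with sign -1. Otherwise [sinks_fibre]
    turns the sum into one over heaps [E] on [S], and [sinks_sign_sum] cancels the contribution of
    each. *)
Lemma pyramids_sign_sum a S : a \in S ->
  \sum_(T : {set I} | [&& T \subset S, stable adj T & a \notin T])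
    (-1) ^+ #|S :\: T| * (size (pyramids a (S :\: T)))%:R
  = - (stable adj S)%:R :> int.
Proof.
move=> aS; have [stS|nst] := boolP (stable adj S).
  rewrite (bigD1 (S :\ a)) /=; last first.
    by rewrite subsetDl (stable_subset _ stS) ?subsetDl // !inE eqxx.
  have eS : S :\: (S :\ a) = [set a].
    apply/setP => x; rewrite !inE negb_and negbK.
    by case: eqP => [->|_]; rewrite ?aS // andNb.
  rewrite big1 ?addr0 => [|T /andP[/and3P[TS stT aT] nT]].
    rewrite eS pyramids_stable ?eqxx ?cards1 ?mulr1 //.
    by rewrite -eS; apply: stable_subset stS; apply: subsetDl.
  rewrite pyramids_stable; last by apply: stable_subset stS; apply: subsetDl.
  case: eqP => [e|]; rewrite ?mulr0 //; case/eqP: nT.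
  by rewrite -e setDDr setDv set0U; apply/esym/setIidPr.
rewrite oppr0.
transitivity (\sum_(T : {set I} | [&& T \subset S, stable adj T & a \notin T])
    \sum_(E <- heaps_on S | sinks T E && pyramid a (res (~: T) E))
      (-1) ^+ #|S :\: T| : int).
  apply: eq_bigr => T /and3P[TS stT _].
  rewrite -big_filter -(perm_big _ (sinks_fibre a TS stT)) /= big_map.
  by rewrite big_const_seq count_predT iter_addr_0 mulr_natr.
rewrite (exchange_big_dep xpredT) //= big_seq big1 // => E Em.
(* Sinks of [E] form a stable set because adjacent pieces are comparable, and the base [a] of the
   remaining pyramid is not in [T]. *)
rewrite -[RHS](sinks_sign_sum a Em nst); apply: eq_bigl => T.
move: Em; rewrite mem_heaps_on => /andP[uE /eqP pE].
case TS: (T \subset S) => //=; case: sinksP => [sT|]; rewrite ?andbF //=.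
case pT: (pyramid a _); rewrite ?andbF //= andbT; apply/andP; split.
  apply/stableP => x y xT yT; apply/negP => Axy.
  have := @harc_total E _ _ Axy; rewrite pE !(subsetP TS) // => /(_ isT isT).
  by rewrite (negPf (sT x y xT)) (negPf (sT y x yT)).
by case/pyramidP: pT => _; rewrite positions_res !inE => /andP[].
Qed.

(** Change of variable: [K] is the disjoint union of [V] and [T]. *)
Lemma exchange_disjoint a S (f : {set I} -> {set I} -> int) : a \in S ->
  \sum_(V : {set I} | (V \subset S) && (a \in V))
    \sum_(T : {set I} | (T \subset S :\: V) && stable adj T) f V T
  = \sum_(K : {set I} | (K \subset S) && (a \in K))
    \sum_(T : {set I} | [&& T \subset K, stable adj T & a \notin T]) f (K :\: T) T.
Proof.
move=> aS; rewrite (exchange_big_dep (fun T => [&& T \subset S, stable adj T & a \notin T])) /=.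
  rewrite [RHS](exchange_big_dep (fun T => [&& T \subset S, stable adj T & a \notin T])) /=.
    apply: eq_bigr => T /and3P[TS stT aT].
    rewrite stT aT (reindex_onto (fun K => K :\: T) (fun V : {set I} => V :|: T)) /=.
      apply: eq_bigl => K; rewrite andbT in_setD aT /=.
      have [TK|nTK] := boolP (T \subset K); last first.
        rewrite !andbF; apply/negbTE/negP => /andP[_ /eqP e].
        by case/negP: nTK; rewrite -e subsetUr.
      have -> : K :\: T :|: T = K by rewrite -{2}(setIidPr TK) setUC setID.
      rewrite eqxx !andbT; have -> : T \subset S :\: (K :\: T).
        by apply/subsetP => x xT; rewrite !inE xT (subsetP TS).
      rewrite andbT; congr (_ && _); apply/subsetP/subsetP => H x.
        by move=> xK; case xT: (x \in T); [exact: (subsetP TS)|apply: H; rewrite inE xT].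
      by rewrite inE => /andP[_ /H].
    move=> V /andP[_ /andP[/subsetDP[_ dis] _]].
    by apply/setP => x; rewrite !inE; case xT: (x \in T) => /=;
       rewrite ?orbF // (disjointFr dis xT).
  move=> K T /andP[KS _] /and3P[TK -> ->]; by rewrite (subset_trans TK).
move=> V T /andP[VS aV] /andP[TV ->] /=.
rewrite (subset_trans TV (subsetDl _ _)) /=; apply/negP => /(subsetP TV).
by rewrite inE aV.
Qed.

(** Strong induction on the size of [S]. With [a] its minimum and [W] the sum over V of p(V)
    P_(S-V)(y-1), the terms with [a] outside [T] add up to y W and those with [a] in [T] to -W. The
    total (y-1) W is P_S(y-1) by the recursion. *)
Lemma heap_sum_sub1 S (y : int) :
  heap_sum S (y - 1)
  = \sum_(T : {set I} | (T \subset S) && stable adj T)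
      (-1) ^+ #|T| * heap_sum (S :\: T) y.
Proof.
have [n] := ubnP #|S|; elim: n S => // n IH S lt.
have [->|[a0 a0S]] := set_0Vmem S.
  rewrite (big_pred1 set0) => [|T].
    by rewrite set0D !heap_sum_nil cards0 mulr1.
  rewrite subset0 /=; case: eqP => //= ->.
  by apply/stableP => x y'; rewrite in_set0.
have [a aS amin] : exists2 a, a \in S & forall x, x \in S -> (a <= x)%O.
  by exists [arg min_(a < a0 in S) a]%O; case: Order.TotalTheory.arg_minP.
pose W : int := \sum_(V : {set I} | (V \subset S) && (a \in V))
    (size (pyramids a V))%:R * heap_sum (S :\: V) (y - 1).
have WE : W = \sum_(V : {set I} | (V \subset S) && (a \in V))
    \sum_(T : {set I} | (T \subset S :\: V) && stable adj T)
      (size (pyramids a V))%:R * ((-1) ^+ #|T| * heap_sum (S :\: V :\: T) y).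
  apply: eq_bigr => V /andP[VS aV]; rewrite -mulr_sumr -IH //.
  apply: leq_trans (_ : (#|S| <= n)%N); last by rewrite -ltnS.
  apply: proper_card; apply/properP; split; first exact: subsetDl.
  by exists a; rewrite // inE aV.
have A : \sum_(T : {set I} | ((T \subset S) && stable adj T) && (a \notin T))
      (-1) ^+ #|T| * heap_sum (S :\: T) y = y * W.
  rewrite WE mulr_sumr.
  transitivity (\sum_(T : {set I} | ((T \subset S) && stable adj T) && (a \notin T))
     \sum_(V : {set I} | (V \subset S :\: T) && (a \in V))
      y * ((size (pyramids a V))%:R * ((-1) ^+ #|T| * heap_sum (S :\: V :\: T) y))).
    apply: eq_bigr => T /andP[/andP[TS stT] aT].
    (* As [a] is not in [T], it is still the minimum of [S :\: T]. *)
    rewrite (@heap_sum_rec a); first last.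
    - by move=> x; rewrite inE => /andP[_ /amin].
    - by rewrite inE aT.
    rewrite !mulr_sumr; apply: eq_bigr => V _.
    rewrite !setDDl [V :|: T]setUC; ring.
  rewrite (exchange_big_dep (fun V : {set I} => (V \subset S) && (a \in V))) /=.
    apply: eq_bigr => V /andP[VS aV]; rewrite mulr_sumr; apply: eq_bigl => T.
    rewrite aV andbT !subsetD VS /= disjoint_sym.
    case: (T \subset S) => //=; case: (stable adj T); rewrite ?andbF //= andbT.
    case dis: [disjoint T & V]; rewrite ?andbF // andbT.
    by rewrite (disjointFl dis aV).
  by move=> T V _ /andP[]; rewrite subsetD => /andP[-> _] ->.
have B : \sum_(T : {set I} | ((T \subset S) && stable adj T) && (a \in T))
      (-1) ^+ #|T| * heap_sum (S :\: T) y = - W.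
  (* Grouped by [K], the inner sum over [T] is the one of [pyramids_sign_sum], which leaves only the
     stable [K] containing [a]. *)
  rewrite WE exchange_disjoint // -sumrN.
  rewrite -(eq_bigl _ _ (fun T => andbAC (T \subset S) (a \in T) (stable adj T))).
  rewrite big_mkcondr /=; apply: eq_bigr => K /andP[KS aK].
  transitivity (- (heap_sum (S :\: K) y * (-1) ^+ #|K| *
     \sum_(T : {set I} | [&& T \subset K, stable adj T & a \notin T])
       ((-1) ^+ #|K :\: T| * (size (pyramids a (K :\: T)))%:R))).
    rewrite pyramids_sign_sum // mulrN opprK.
    by case: (stable adj K); rewrite ?mulr0 // mulr1 mulrC.
  congr (- _); rewrite mulr_sumr; apply: eq_bigr => T /and3P[TK stT aT].
  have -> : S :\: (K :\: T) :\: T = S :\: K.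
    by rewrite setDDl setUC -{1}(setIidPr TK) setID.
  have -> : #|K| = (#|T| + #|K :\: T|)%N by rewrite -(cardsID T K) (setIidPr TK).
  rewrite exprD; set e := (-1) ^+ #|K :\: T|; set h := heap_sum _ _.
  have ee : e * e = 1 by rewrite -expr2 sqrr_sign.
  rewrite -[RHS]mul1r -[X in _ = X * _]ee; ring.
rewrite (bigID (fun T : {set I} => a \in T)) /= A B.
rewrite (@heap_sum_rec a) // -/W; ring.
Qed.

(** * Colourings *)

Lemma heap_sum0 S : heap_sum S 0 = (S == set0)%:R.
Proof.
case: eqP => [->|/eqP/set0Pn[a0 a0S]]; first exact: heap_sum_nil.
have [a aS amin] : exists2 a, a \in S & forall x, x \in S -> (a <= x)%O.
  by exists [arg min_(a < a0 in S) a]%O; case: Order.TotalTheory.arg_minP.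
by rewrite (heap_sum_rec _ aS amin) mul0r.
Qed.

(* Colourings of the subgraph induced on S with the first q of the Q + 1
   colours, extended by the dummy value 0 outside S. *)
Definition colouring_on (Q q : nat) S (c : {ffun I -> 'I_Q.+1}) : bool :=
  [forall x, if x \in S then (c x < q)%N else c x == ord0]
  && [forall x in S, forall y in S, adj x y ==> (c x != c y)].

Lemma colouring_onP (Q q : nat) S (c : {ffun I -> 'I_Q.+1}) : reflect
  [/\ {in S, forall x, (c x < q)%N}, forall x, x \notin S -> c x = ord0
    & {in S &, forall x y, adj x y -> c x != c y}] (colouring_on q S c).
Proof.
apply: (iffP andP) => [[/forallP H1 /forall_inP H2]|[H1 H2 H3]]; split.
- by move=> x xS; have := H1 x; rewrite xS.
- by move=> x xS; have := H1 x; rewrite (negPf xS) => /eqP.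
- by move=> x y xS yS; apply: (implyP (forall_inP (H2 x xS) y yS)).
- by apply/forallP => x; case: ifPn => [/H1|/H2->].
- apply/forall_inP => x xS; apply/forall_inP => y yS.
  by apply/implyP; apply: H3.
Qed.

(** [T] is the class of the top colour [q]; erasing it leaves a colouring of the rest with the first
    [q] colours. *)
Lemma card_colouring_on_rec (Q q : nat) S : (q <= Q)%N ->
  #|[set c : {ffun I -> 'I_Q.+1} | colouring_on q.+1 S c]|
  = (\sum_(T : {set I} | (T \subset S) && stable adj T)
      #|[set c : {ffun I -> 'I_Q.+1} | colouring_on q (S :\: T) c]|)%N.
Proof.
move=> qQ; rewrite -sum1dep_card.
rewrite (partition_big (fun c : {ffun I -> 'I_Q.+1} => [set x in S | c x == q :> nat])
  (fun T => (T \subset S) && stable adj T)) /=; last first.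
  move=> c /colouring_onP[_ _ H]; apply/andP; split.
    by apply/subsetP => x; rewrite inE => /andP[].
  apply/stableP => x y; rewrite !inE => /andP[xS /eqP cx] /andP[yS /eqP cy].
  apply/negP => /(H x y xS yS)/eqP; apply; apply: val_inj => /=.
  by rewrite cx cy.
apply: eq_bigr => T /andP[TS stT]; rewrite -sum1dep_card.
(* [col] paints [T] with colour [q], where [q <= Q] makes [inord q] equal to [q]; [uncol] restores
   the dummy value there. *)
pose col (c : {ffun I -> 'I_Q.+1}) := [ffun x => if x \in T then inord q else c x].
pose uncol (c : {ffun I -> 'I_Q.+1}) := [ffun x => if x \in T then ord0 else c x].
have qE : @inord Q q = q :> nat by rewrite inordK.
rewrite (reindex_onto col uncol) /=; last first.
  move=> c /andP[_ /eqP eT]; apply/ffunP => x; rewrite !ffunE.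
  case: ifPn => xT; last by rewrite (negPf xT).
  apply: val_inj; apply: etrans qE _.
  by move: xT; rewrite -eT inE => /andP[_ /eqP].
apply: eq_bigl => c; apply/idP/colouring_onP.
  move=> /andP[/andP[/colouring_onP[H1 H2 H3] /eqP eT] /eqP ec]; split.
  - move=> x; rewrite inE => /andP[xT xS]; have := H1 x xS.
    rewrite ffunE (negPf xT) ltnS leq_eqVlt => /orP[/eqP cq|//].
    have := negPf xT; rewrite -{1}eT inE xS ffunE (negPf xT) /=.
    by move/eqP; rewrite cq.
  - move=> x; rewrite inE negb_and negbK => /orP[xT|xS].
      by rewrite -ec ffunE xT.
    have xT : (x \in T) = false by apply: contraNF xS; apply: (subsetP TS).
    by have := H2 x xS; rewrite ffunE xT.
  - move=> x y; rewrite !inE => /andP[xT xS] /andP[yT yS] Axy.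
    by have := H3 x y xS yS Axy; rewrite !ffunE (negPf xT) (negPf yT).
move=> [H1 H2 H3]; apply/andP; split; first (apply/andP; split).
- apply/colouring_onP; split.
  + move=> x xS; rewrite ffunE; case: ifPn => xT; first by rewrite qE.
    by rewrite ltnW // ltnS H1 // inE xT xS.
  + move=> x xS; rewrite ffunE ifF; first by apply: H2; rewrite inE (negPf xS) andbF.
    by apply: contraNF xS; apply: (subsetP TS).
  + move=> x y xS yS Axy; rewrite !ffunE; case: ifPn => xT; case: ifPn => yT.
    * by have /stableP/(_ x y xT yT) := stT; rewrite Axy.
    * by rewrite -val_eqE /= qE neq_ltn H1 ?orbT // inE yT yS.
    * by rewrite -val_eqE /= qE neq_ltn H1 // inE xT xS.
    * by apply: H3; rewrite // inE ?xT ?yT.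
- apply/eqP/setP => x; rewrite inE ffunE; case: ifPn => xT.
    by rewrite qE eqxx (subsetP TS).
  have [xS|//] := boolP (x \in S); apply: ltn_eqF; apply: H1.
  by rewrite inE xT xS.
- apply/eqP/ffunP => x; rewrite !ffunE; case: ifPn => xT.
    by rewrite H2 // inE xT.
  by rewrite (negPf xT).
Qed.

(** Both sides satisfy the same recursion in [q]: [heap_sum_sub1] at y = -q matches the removal of a
    colour class. *)
Lemma card_colouring_on (Q q : nat) S : (q <= Q.+1)%N ->
  #|[set c : {ffun I -> 'I_Q.+1} | colouring_on q S c]|%:R
  = (-1) ^+ #|S| * heap_sum S (- q%:R) :> int.
Proof.
elim: q S => [|q IH] S qQ.
  rewrite oppr0 heap_sum0; case: eqP => [->|/eqP/set0Pn[x xS]].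
    rewrite cards0 mul1r (_ : [set c | _] = [set [ffun=> ord0]]) ?cards1 //.
    apply/setP => c; rewrite !inE; apply/colouring_onP/eqP => [[_ H _]|->].
      by apply/ffunP => x; rewrite ffunE H ?in_set0.
    by split=> x; rewrite ?in_set0 // ffunE.
  rewrite mulr0 (_ : [set c | _] = set0) ?cards0 //.
  by apply/setP => c; rewrite !inE; apply/colouring_onP => -[/(_ x xS)].
rewrite card_colouring_on_rec // natr_sum.
have -> : - (q.+1)%:R = - q%:R - 1 :> int by rewrite -addn1 natrD opprD.
rewrite heap_sum_sub1 mulr_sumr; apply: eq_bigr => T /andP[TS _].
rewrite IH; last exact: ltnW.
have -> : #|S| = (#|S :\: T| + #|T|)%N by rewrite -(cardsID T S) (setIidPr TS) addnC.
rewrite exprD -!mulrA; congr (_ * _); rewrite mulrA -expr2 sqrr_sign mul1r //.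
Qed.

(** * The chromatic polynomial as a signed sum over heaps *)

Lemma chrom_poly_heaps : chrom_poly adj =
  \sum_(E <- heaps_on setT) (-1) ^+ (#|I| + size (factors E)) *: 'X^(size (factors E)).
Proof.
symmetry; apply: chrom_poly_uniq => q.
transitivity ((-1) ^+ #|[set: I]| * heap_sum setT (- q%:R)).
  rewrite horner_sum mulr_sumr; apply: eq_bigr => E _.
  by rewrite hornerZ hornerXn cardsT exprD -mulrA -exprMn mulN1r.
(* [card_colouring_on] needs colours in an ordinal type of successor form, so q = 0 is treated
   separately. *)
case: q => [|q]; last first.
  rewrite -(@card_colouring_on q) //; congr _%:R; apply: eq_card => c.
  rewrite !inE; apply/colouring_onP/forallP => [[_ _ H] x|H].
    by apply/forallP => y; apply/implyP; apply: H; rewrite in_setT.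
  split=> [x _|x|x y _ _]; rewrite ?in_setT // ?ltn_ord //.
  exact: (implyP (forallP (H x) y)).
rewrite oppr0 heap_sum0; case: eqP => [e|/eqP/set0Pn[x _]].
  have I0 (x : I) : False by have := in_setT x; rewrite e in_set0.
  rewrite e cards0 mulr1 (_ : [set c | _] = setT).
    by rewrite cardsT card_ffun -[#|I|]cardsT e cards0.
  by apply/setP => c; rewrite !inE; apply/forallP => x; case: (I0 x).
rewrite mulr0 (_ : [set c | _] = set0) ?cards0 //.
by apply/setP => c; case: (c x).
Qed.

Lemma chrom_tilde_heaps (lambda m : nat) : (m <= #|I|)%N ->
  chrom_tilde adj m lambda%:Z
  = (\sum_(E <- heaps_on setT)
      size (factors E) ^_ m * lambda ^ (size (factors E) - m))%N%:Z.
Proof.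
move=> le_mn; rewrite /chrom_tilde chrom_poly_heaps raddf_sum /= horner_sum mulr_sumr.
rewrite -[RHS]natz natr_sum; apply: eq_bigr => E _.
move: (size _) => k; rewrite derivnZ hornerZ derivnXn hornerMn hornerXn.
have [lt_km|le_mk] := ltnP k m; first by rewrite ffact_small // mulr0n !mulr0.
rewrite natrM natrX -mulr_natr -(mulN1r lambda%:Z) exprMn !natz [RHS]mulrC !mulrA.
(* With n the number of vertices, the signs have exponents n - m, n + k and k - m. Their sum is
   even, the subtractions being exact since m <= n and m <= k. *)
rewrite -!exprD -signr_odd (_ : odd _ = false) ?mul1r //.
by rewrite !oddD !oddB //; do 3 case: (odd _).
Qed.

Local Open Scope nat_scope.

(** * Labellings *)

Lemma find_factor s i x : sqf (hprod s) -> i < size s ->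
  (find (fun F => x \in positions F) s == i)
    = (x \in positions (nth (heap_nil adj) s i)).
Proof.
elim: s i => //= F s IH i; rewrite sqf_mul => /and3P[_ us dis].
case: i => [|i]; first by case: (x \in positions F).
rewrite ltnS => lt; case xF: (x \in positions F); last by rewrite eqSS IH.
symmetry; apply: contraFF (disjointFr dis xF) => xi.
by rewrite positions_hprod; apply/hasP; exists (nth (heap_nil adj) s i); rewrite ?mem_nth.
Qed.

Definition block E x := find (fun F => x \in positions F) (factors E).

Lemma block_eq E j x : sqf E -> j < size (factors E) ->
  (block E x == j) = (x \in positions (nth (heap_nil adj) (factors E) j)).
Proof.
by move=> uE; apply: find_factor; have [<- _ _] := factorsP uE.
Qed.

Lemma block_lt E x : E \in heaps_on setT -> block E x < size (factors E).
Proof.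
rewrite mem_heaps_on => /andP[uE /eqP pE]; rewrite -has_find -positions_hprod.
by have [<- _ _] := factorsP uE; rewrite pE in_setT.
Qed.

Lemma block_surj E j : sqf E -> j < size (factors E) -> exists x, block E x = j.
Proof.
move=> uE lt; have [_ lynE _] := factorsP uE.
have [nF _ _] := lynE _ (mem_nth (heap_nil adj) lt).
have [/positions_eq0//|[x xF]] := set_0Vmem (positions (nth (heap_nil adj) (factors E) j)).
by exists x; apply/eqP; rewrite block_eq.
Qed.

Definition label_bound (m lambda k j : nat) := if j < m then k - j else lambda.

(** A common bound for all blocks, so that labels fit into the single finite type
    ['I_(k + lambda)]. *)
Lemma label_bound_le m lambda k j : label_bound m lambda k j <= k + lambda.
Proof. by rewrite /label_bound; case: ifP => _; lia. Qed.

(** A labelling is a function [g] on the indices of the factors. [g] stores the label minus one,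
    hence the successor; the default 0 is not reached when every vertex lies in a factor, see
    [block_lt]. *)
Definition labels (m lambda : nat) E : seq {ffun I -> nat} :=
  let k := size (factors E) in
  if m <= k then
    [seq [ffun x => oapp (fun j : 'I_k => (g j : nat).+1) 0 (insub (block E x))]
       | g : {ffun 'I_k -> 'I_(k + lambda)}
           in family (fun j : 'I_k => [pred i : 'I_(k + lambda)
                                         | i < label_bound m lambda k j])]
  else [::].

Lemma mem_labels m lambda E f : E \in heaps_on setT ->
  (f \in labels m lambda E) <-> labelling m lambda E f.
Proof.
move=> Em; have := Em; rewrite mem_heaps_on => /andP[uE _].
rewrite /labels /labelling; set k := size (factors E); split.
  case: ifP => // le_mk /imageP[g /familyP gF ->].
  exists (factors E); split=> //; first exact: factorsP.
  move=> j lt_jk; have val x : x \in positions (nth (heap_nil adj) (factors E) j) ->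
     insub (block E x) = Some (Ordinal lt_jk).
    by rewrite -block_eq // => /eqP->; rewrite insubT.
  split=> [x y /val ex /val ey|x /val ex]; rewrite !ffunE ex ?ey //=.
  exact: (gF (Ordinal lt_jk)).
case=> Es [fE]; rewrite (lyndon_factorization_uniq uE fE (factorsP uE)) -/k.
move=> -> H; have Hf x : 1 <= f x <= label_bound m lambda k (block E x).
  have [_ /(_ x)] := H _ (block_lt x Em); rewrite -block_eq ?block_lt //.
  by rewrite eqxx => /(_ isT).
have bnd x : (f x).-1 < k + lambda.
  case/andP: (Hf x) => f1 f2; rewrite prednK //.
  exact: leq_trans f2 (label_bound_le _ _ _ _).
(* Read [g j] off at any vertex of the j-th factor. Factors are nonempty, so the [else] branch only
   fills the type. *)
apply/imageP; exists [ffun j : 'I_k =>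
    if [pick x | block E x == j] is Some x then Ordinal (bnd x)
    else widen_ord (leq_addr lambda k) j].
  apply/familyP => j; rewrite inE ffunE; case: pickP => [x /eqP ex|no].
    by rewrite -ex /=; case/andP: (Hf x) => f1; rewrite prednK.
  by have [x ex] := block_surj uE (ltn_ord j); have := no x; rewrite /= ex eqxx.
apply/ffunP => x; rewrite ffunE insubT ?block_lt //= => lt; rewrite ffunE.
case: pickP => [y /= /eqP ey|/(_ x)]; last by rewrite /= eqxx.
rewrite prednK; last by case/andP: (Hf y).
have [+ _] := H _ lt; apply; rewrite -block_eq //; exact/eqP.
Qed.

Lemma labels_uniq m lambda E : E \in heaps_on setT -> uniq (labels m lambda E).
Proof.
move=> Em; have := Em; rewrite mem_heaps_on => /andP[uE _].
rewrite /labels; case: ifP => // _; rewrite map_inj_uniq ?enum_uniq //.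
move=> g g' /ffunP e; apply/ffunP => j; apply: val_inj.
have [x ex] := block_surj uE (ltn_ord j); have := e x.
by rewrite !ffunE ex valK /= => -[].
Qed.

(** The first [m] blocks offer k, k - 1, ..., k - m + 1 labels and each remaining one [lambda]. For
    k < m the falling factorial vanishes, matching the empty list. *)
Lemma size_labels m lambda E :
  size (labels m lambda E) = size (factors E) ^_ m * lambda ^ (size (factors E) - m).
Proof.
rewrite /labels; set k := size (factors E); case: ifPn => [le_mk|]; last first.
  by rewrite -ltnNge => lt_km; rewrite ffact_small.
have cardF (j : 'I_k) : #|[pred i : 'I_(k + lambda) | i < label_bound m lambda k j]|
    = label_bound m lambda k j.
  rewrite -[RHS]card_ord -!sum1_card.
  by rewrite [RHS](big_ord_widen _ (fun=> 1) (label_bound_le m lambda k j)).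
rewrite size_map -cardE card_family foldrE big_map big_enum /=.
rewrite (eq_bigr (fun j : 'I_k => label_bound m lambda k j)) => [|j _]; last exact: cardF.
rewrite -(big_mkord xpredT (label_bound m lambda k)) (big_cat_nat (leq0n m) le_mk) //=.
congr (_ * _).
  rewrite ffact_prod -(big_mkord xpredT (fun j => k - j)).
  by apply: eq_big_nat => j /= lt_jm; rewrite /label_bound lt_jm.
rewrite -prod_nat_const_nat; apply: eq_big_nat => j /andP[le_mj _].
by rewrite /label_bound ltnNge le_mj.
Qed.

(** * Orientations and the final count *)

(** Chains of pieces move forward in the word, and adjacent pieces in that order already form one
    step; so on edges the transitive closure adds nothing to the arcs. *)
Lemma orientationE E a b : sqf E ->
  ((a, b) \in orientation_of E) = harc E a b.
Proof.
move=> uE; rewrite inE /= /harc /warc; case Aab: (adj a b) => //=.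
have ltE s t : @piece_lt _ _ adj (repr E) s t -> s < t.
  by elim=> {s t} [s t []|s t r _ st _ tr] //; apply: ltn_trans tr.
have idx (s : 'I_(size (repr E))) : index (tnth (in_tuple (repr E)) s) (repr E) = s.
  by rewrite (tnth_nth a) index_uniq.
apply/asboolP/and3P => [[s [t [<- <- /ltE st]]]|[aE bE lt]].
  by rewrite !idx !mem_tnth.
have lta : index a (repr E) < size (repr E) by rewrite index_mem.
have ltb : index b (repr E) < size (repr E) by rewrite index_mem.
have ea : tnth (in_tuple (repr E)) (Ordinal lta) = a.
  by rewrite (tnth_nth a) /= nth_index.
have eb : tnth (in_tuple (repr E)) (Ordinal ltb) = b.
  by rewrite (tnth_nth a) /= nth_index.
exists (Ordinal lta), (Ordinal ltb); split=> //.
by apply: t_step; split=> //=; rewrite ea eb; right.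
Qed.

(** Ensures that pairs of an orientation and a labelling are counted once per pair of a heap and a
    labelling. *)
Lemma orientation_inj : {in heaps_on setT &, injective (@orientation_of d I adj)}.
Proof.
move=> E F; rewrite !mem_heaps_on => /andP[uE /eqP pE] /andP[uF /eqP pF] e.
apply: heap_ext => //; first by rewrite pE.
by move=> x y; rewrite -!orientationE // e.
Qed.

Lemma multilinearP E : multilinear E <-> E \in heaps_on setT.
Proof.
rewrite mem_heaps_on; split=> [mE|/andP[uE /eqP pE] x].
  have inE' x : x \in repr E by rewrite -has_pred1 has_count mE.
  apply/andP; split; last by apply/eqP/setP => x; rewrite mem_positions inE' in_setT.
  by apply: count_mem_uniq => x; rewrite mE inE'.
by rewrite count_uniq_mem // -mem_positions pE in_setT.
Qed.

Definition labelled_orientations (m lambda : nat) :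
    seq ({set I * I} * {ffun I -> nat}) :=
  [seq (orientation_of E, f) | E <- heaps_on setT, f <- labels m lambda E].

Lemma labelled_orientations_uniq m lambda : uniq (labelled_orientations m lambda).
Proof.
apply: allpairs_uniq_dep; first exact: heaps_on_uniq.
  by move=> E; apply: labels_uniq.
move=> _ _ /allpairsPdep[E [f [Em _ ->]]] /allpairsPdep[F [g [Fm _ ->]]] /= [e ->].
by rewrite (orientation_inj Em Fm e).
Qed.

Lemma mem_labelled_orientations m lambda Of :
  Of \in labelled_orientations m lambda <->
  labelled_acyclic_orientation adj m lambda Of.
Proof.
split=> [/allpairsPdep[E [f [Em fL ->]]]|[E [mE eO lE]]].
  exists E; split=> //=; first exact/multilinearP.
  exact/mem_labels.
have Em : E \in heaps_on setT by apply/multilinearP.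
apply/allpairsPdep; exists E, Of.2; split=> //; first exact/mem_labels.
by rewrite -eO; case: Of {eO lE}.
Qed.

End HeapsOfGraph.

Lemma card_eq_seq (T : choiceType) (s : seq T) : uniq s ->
  ([set x | x \in s]%classic #= `I_(size s))%card.
Proof.
case: s => [|x0 s] us.
  by rewrite (_ : [set x | x \in [::]]%classic = classical_sets.set0) ?II0 //; apply/seteqP; split.
set t := x0 :: s in us *.
rewrite (_ : [set x | x \in t]%classic = (nth x0 t @` `I_(size t))%classic).
  apply: inj_card_eq => i j; rewrite !classical_sets.in_setE /= => lti ltj /eqP.
  by rewrite nth_uniq // => /eqP.
apply/seteqP; split=> x => [xt|[i lti <-]]; last exact: mem_nth.
have {}xt : x \in t := xt.
by exists (index x t); [rewrite -index_mem in xt|apply: nth_index].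
Qed.

Theorem theorem1p10 (d : Order.disp_t) (I : finOrderType d) (adj : rel I)
    (adj_sym : symmetric adj) (adj_irr : irreflexive adj)
    (lambda m : nat) (lambda_gt0 : (0 < lambda)%N) (le_mn : (m <= #|I|)%N) :
  exists2 N : nat,
    ([set Of | labelled_acyclic_orientation adj m lambda Of]%classic #= `I_N)%card
    & chrom_tilde adj m (lambda%:Z)%R = N%:Z%R.
Proof.
exists (size (labelled_orientations adj m lambda)).
  rewrite (_ : [set Of | _]%classic
             = [set Of | Of \in labelled_orientations adj m lambda]%classic).
    exact/card_eq_seq/labelled_orientations_uniq.
  by apply/seteqP; split=> Of /(mem_labelled_orientations adj_sym adj_irr).
(* Both sides are now sums over the multilinear heaps, compared heap by heap through
   [size_labels]. *)
rewrite chrom_tilde_heaps //; congr Posz.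
rewrite size_allpairs_dep sumnE big_map; apply: eq_bigr => E _.
by rewrite size_labels.
Qed.
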